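(* For every constant $D\in(0,1)$ there exists a constant $C=C(D)>0$, depending only on $D$, such that the following holds. Let $\mathcal{H}$ be a finite arrangement of affine hyperplanes in general position in $\mathbb{R}^3$, let $\mathcal{R}(\mathcal{H})$ be the set of all its chambers, and let $S\subseteq\mathcal{R}(\mathcal{H})$ satisfy $$|S|=\sum_{i=0}^3\binom{k}{i}\quad\text{for some real }k\ge 2,\qquad\text{and}\qquad |S|\le D\cdot|\mathcal{R}(\mathcal{H})| .$$ Then the edge boundary of $S$ in the chamber graph satisfies $$|\partial S|\ \ge\ C\sum_{\substack{A\in\operatorname{supp}(S)\\ 0\le|A|\le 2}}|\operatorname{conn}(T_S(A))| .$$ In particular, $$|\partial S|\ \ge\ C\sum_{i=0}^2\binom{k}{i}.$$ Hence $|\partial S|=\Omega(|S|^{2/3})$, with implied constant depending only on $D$.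
   Context: Arrangement: $\mathcal{H}=\{H_1,\dots,H_n\}$ is a finite set of affine hyperplanes in $\mathbb{R}^3$. Chambers are the connected components of $\mathbb{R}^3\setminus\bigcup_i H_i$. General position in $\mathbb{R}^d$ (here $d=3$): the intersection of any $k\le d$ hyperplanes of $\mathcal{H}$ is an affine subspace of dimension $d-k$, and no $d+1$ hyperplanes have a common point. Chamber graph: vertices are the chambers; two chambers are adjacent iff they share a common facet (equivalently, are separated by exactly one hyperplane of $\mathcal{H}$). The edge boundary $\partial S$ is the set of edges of the chamber graph with exactly one endpoint in $S$. For a set $S$ of chambers, its thickening is $T_S:=\operatorname{int}\bigl(\overline{\bigcup_{C\in S}C}\bigr)$. For $A\subseteq[n]=\{1,\dots,n\}$ let $L_A:=\bigcap_{f\in A}H_f$ (with $L_\emptyset=\mathbb{R}^3$) and $T_S(A):=T_S\cap L_A$ (the stratum of $A$). The support is $\operatorname{supp}(S):=\{A\subseteq[n]\mid T_S(A)\ne\emptyset\}$. For $A\in\operatorname{supp}(S)$, $\operatorname{conn}(T_S(A))$ is the set of connected components of $T_S(A)$. For real $x$ and integer $i\ge 0$, $\binom{x}{i}:=\frac{x(x-1)\cdots(x-i+1)}{i!}$. *)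

(* Defs.v *)
From HB Require Import structures.
From mathcomp Require Import all_boot all_order all_algebra finmap.
From mathcomp Require Import all_classical all_reals all_analysis.

Set Implicit Arguments.
Unset Strict Implicit.
Unset Printing Implicit Defensive.

Import Order.TTheory GRing.Theory Num.Theory.
Import numFieldNormedType.Exports.

Local Open Scope classical_set_scope.
Local Open Scope ring_scope.

(* The number of elements of a finite set; [fset_set] sends an infinite set to
   the empty one, but every set counted below is finite. *)
Definition ncard (T : choiceType) (A : set T) : nat := #|` fset_set A|%fset.

Definition rbinom (R : realType) (x : R) (i : nat) : R :=
  (\prod_(j < i) (x - j%:R)) / i`!%:R.

Section AffineGeometry.
Variables (R : realType) (d : nat).
Implicit Types (L P F : set 'rV[R]_d).

(* The rows of [M] span the direction space of [L]. *)
Definition affine_subspace (m : nat) L : Prop :=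
  exists (p : 'rV[R]_d) (M : 'M[R]_d),
    \rank M = m /\ L = [set x | (x - p <= M)%MS].

Definition affine_hull F : set 'rV[R]_d :=
  \bigcap_(L in [set L | (exists m, affine_subspace m L) /\ F `<=` L]) L.

(* A facet of a [d]-dimensional polyhedron [P]: its intersection with a
   supporting hyperplane, when this has affine dimension [d - 1]. *)
Definition facet P F : Prop :=
  (exists (a : 'cV[R]_d) (c : R),
    [/\ a != 0,
        forall x, P x -> (x *m a) 0 0 <= c
      & F = P `&` [set x | (x *m a) 0 0 = c]]) /\
  affine_subspace d.-1 (affine_hull F).

End AffineGeometry.

Definition conn (T : topologicalType) (X : set T) : set (set T) :=
  [set connected_component X x | x in X].

Section Arrangements.
Variables (R : realType) (d n : nat).
Variable H : 'I_n -> set 'rV[R]_d.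
Implicit Types (A : {set 'I_n}) (C : set 'rV[R]_d) (S : set (set 'rV[R]_d)).

Definition arrangement : Prop := forall i, affine_subspace d.-1 (H i).

Definition flat A : set 'rV[R]_d := \bigcap_(f in [set` A]) H f.

(* The members of a family satisfying this are pairwise distinct as soon as
   [2 <= d], so that [H] enumerates a set of [n] hyperplanes. *)
Definition general_position : Prop :=
  (forall A, (#|A| <= d)%N -> affine_subspace (d - #|A|) (flat A)) /\
  (forall A, #|A| = d.+1 -> flat A = set0).

Definition chambers : set (set 'rV[R]_d) := conn (~` \bigcup_i H i).

Definition chamber_adj C C' : Prop :=
  C <> C' /\ exists F, facet (closure C) F /\ facet (closure C') F.

Definition chamber_edges : set (set (set 'rV[R]_d)) :=
  [set e | exists C C', [/\ chambers C, chambers C', chamber_adj C C'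
                          & e = [set C; C']]].

Definition edge_boundary S : set (set (set 'rV[R]_d)) :=
  [set e | chamber_edges e /\ exists! C, (e `&` S) C].

Definition thickening S : set 'rV[R]_d :=
  interior (closure (\bigcup_(C in S) C)).

Definition stratum S A : set 'rV[R]_d := thickening S `&` flat A.

Definition supp S : {set {set 'I_n}} :=
  [set A | `[< stratum S A !=set0 >]]%SET.

End Arrangements.

(* Main.v *)
Require Import Defs.
From HB Require Import structures.
From mathcomp Require Import all_boot all_order all_algebra finmap.
From mathcomp Require Import all_classical all_reals all_analysis.
From mathcomp Require Import zify ring lra.

Set Implicit Arguments.
Unset Strict Implicit.
Unset Printing Implicit Defensive.

Import Order.TTheory GRing.Theory Num.Theory.
Import numFieldNormedType.Exports.

Local Open Scope classical_set_scope.
Local Open Scope ring_scope.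

(** The boundary is compared with everything else by charging, with the help of
a linear functional [f] that is constant along no line of the arrangement. A
point is in the thickening iff all the chambers having it in their closure are in
[S] ([thickeningE]), so the strata can be read off from sign vectors. Write [b] for
the number of boundary facets, each seen from both of its sides.

The three lines through a vertex are oriented upwards by [f]. The chamber spanned
by the three upward edges has the vertex as its lowest point, so different vertices
have different such chambers ([upper_inj]). Hence, using [f] and [- f], at most
[2 * b] vertices are good, which means that a boundary facet separates one of their
two extreme chambers from a neighbour ([card_good_vertices]). At any other vertex, the
family is constant on each of the two stars made of an extreme chamber and its
three neighbours ([star_cover]); so the vertex is surrounded by [S], misses [S], or
is a monkey saddle ([saddle_vertex]).

A component of the thickening on a line which is not the whole line has an end.
There four chambers on one side of a plane are in [S] and not all eight are, which
does not happen at a monkey saddle: ends are good vertices, and there are at most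
[12 * b] of them ([card_line_ends]). In a plane or in space, a component that meets a
line is counted with a piece of this line. Otherwise it is a single chamber, which
has a boundary facet, or a single face without edges inside the thickening. If no
vertex of this face is good, all of them are monkey saddles, each being the lowest
or the highest vertex of the face; then one of the edges at such a vertex is a ray
([ray_edge]), and a boundary facet next to the face has the same ray as an edge. A
facet has at most two rays going upwards ([top_side]), so the number of such faces
is again at most a multiple of [b] ([card_isolated_faces]).

The same charges show that all but a multiple of [b] of the chambers in [S] have a
vertex inside the thickening ([card_chambers_le]). Such a vertex is a triangle in the
graph of the pairs of planes whose common line meets the thickening, and a graph
with [m] edges has at most about [m ^ (3/2)] triangles ([card_triangles]).

It remains to bound by a multiple of [b] the number of lines inside the thickening,
and here the hypothesis with [D] enters. Apply the previous paragraph to the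
complementary family, which has at least a fixed proportion of the order of
[n ^ 3] chambers: either [b] is at least of the order of [n ^ 2], the number of all
lines, or a positive proportion of the planes carry whole lines of the complement
([lines_dichotomy]). A plane carrying a whole line of [S] and one carrying a whole
line of the complement meet in a line that has an end, so the product of the numbers
of these two kinds of planes is at most a multiple of [b] ([card_touched]). Thus the
lines inside the thickening are at most a multiple of [b] ([whole_bound]), the first
inequality follows, and [|S| ^ 2] is at most a multiple of [b ^ 3]
([family_bound]), which gives the other two. *)

(** * Signs, vertices and cells of planes in general position *)

Definition dot (R : realType) (x : 'rV[R]_3) (u : 'cV[R]_3) : R :=
  (x *m u) 0 0.

Section Dot.
Variable R : realType.
Implicit Types (x y : 'rV[R]_3) (u : 'cV[R]_3) (t : R).

Lemma dotD x y u : dot (x + y) u = dot x u + dot y u.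
Proof. by rewrite /dot mulmxDl mxE. Qed.

Lemma dotZ t x u : dot (t *: x) u = t * dot x u.
Proof. by rewrite /dot -scalemxAl mxE. Qed.

Lemma dotB x y u : dot (x - y) u = dot x u - dot y u.
Proof. by rewrite /dot mulmxBl !mxE. Qed.

Lemma dotNr x u : dot x (- u) = - dot x u.
Proof. by rewrite /dot mulmxN mxE. Qed.

Lemma dot_sum (I : Type) (r : seq I) (P : pred I) (F : I -> 'rV[R]_3) u :
  dot (\sum_(i <- r | P i) F i) u = \sum_(i <- r | P i) dot (F i) u.
Proof. by rewrite /dot mulmx_suml summxE. Qed.

End Dot.

(** Three planes of such a family meet in exactly one point and a fourth one
misses it, so the vertices are indexed by the sets of three planes. *)
Record simple_planes (R : realType) (n : nat) := SimplePlanes {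
  normal : 'I_n -> 'cV[R]_3;
  offset : 'I_n -> R;
  three_planes : (2 < n)%N;
  normals_free : forall (A : {set 'I_n}) (d : 'rV[R]_3), #|A| = 3%N ->
    (forall i, i \in A -> dot d (normal i) = 0) -> d = 0;
  no_four_concur : forall (A : {set 'I_n}) (x : 'rV[R]_3), #|A| = 4%N ->
    ~ (forall i, i \in A -> dot x (normal i) = offset i)
}.

(** A chamber is encoded by the side of each plane on which it lies. *)
Notation signs n := {ffun 'I_n -> bool}.

Definition sg (R : realType) (b : bool) : R := if b then 1 else -1.

Section Sg.
Variable R : realType.

Lemma sgN b : sg R (~~ b) = - sg R b.
Proof. by case: b => /=; rewrite ?opprK. Qed.

Lemma sg_sq b : sg R b * sg R b = 1.
Proof. by case: b; rewrite /sg; lra. Qed.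

Lemma sg_neq0 b : sg R b != 0.
Proof. by case: b; rewrite /sg ?oppr_eq0 oner_eq0. Qed.

Lemma sg_pos (r : R) : r != 0 -> 0 < sg R (0 < r) * r.
Proof. by move=> r0; case: (ltrgt0P r) r0 => //= r0 _; rewrite /sg; lra. Qed.

Lemma sg_posE b (r : R) : 0 < sg R b * r -> (0 < r) = b.
Proof. by case: b; rewrite /sg => hr; apply/idP; lra. Qed.

Lemma sg_pos_eq b b' (r : R) : 0 < sg R b * r -> 0 < sg R b' * r -> b = b'.
Proof. by move=> /sg_posE <- /sg_posE <-. Qed.

Lemma sg_pos_weak b b' (r : R) : 0 < sg R b * r -> 0 <= sg R b' * r -> b = b'.
Proof. by case: b; case: b'; rewrite /sg => //; lra. Qed.

End Sg.

(** One step length serves finitely many strict inequalities; with it points are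
moved off a flat, or along one, without leaving a cell. *)
Lemma small_step (R : realType) (I : finType) (Q : pred I) (u v : I -> R) :
  (forall i, Q i -> 0 < u i) ->
  exists2 d0 : R, 0 < d0 &
    forall d i, 0 < d -> d <= d0 -> Q i -> 0 < u i + d * v i.
Proof.
move=> hu.
have [d0 d00 hd] : exists2 d0 : R, 0 < d0 &
    forall d i, i \in enum I -> 0 < d -> d <= d0 -> Q i -> 0 < u i + d * v i.
  elim: (enum I) => [|i s [d0 d00 IH]]; first by exists 1.
  case Qi: (Q i); last first.
    exists d0 => // d j; rewrite inE => /orP[/eqP->|js] d1 d2 Qj; last exact: IH.
    by rewrite Qi in Qj.
  have ui := hu _ Qi.
  have vi : 0 < `|v i| + 1 by rewrite ltr_wpDl.
  exists (Num.min d0 (u i / (`|v i| + 1))); first by rewrite lt_min d00 divr_gt0.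
  move=> d j; rewrite inE => /orP[/eqP->|js] dpos; rewrite le_min => /andP[d1 d2] Qj;
    last exact: IH.
  move: d2; rewrite ler_pdivlMr // => d2.
  have hv : - v i <= `|v i| by rewrite -normrN ler_norm.
  by have := ler_wpM2l (ltW dpos) hv; lra.
by exists d0 => // d i d1 d2; apply: hd; rewrite // mem_enum.
Qed.

Lemma subset_between (T : finType) (X Z : {set T}) k : X \subset Z ->
  (#|X| <= k)%N -> (k <= #|Z|)%N ->
  exists B : {set T}, [/\ X \subset B, B \subset Z & #|B| = k].
Proof.
move=> + + kZ; move hm: (k - #|X|)%N => m.
elim: m X hm => [|m IH] X hm XZ Xk.
  exists X; split=> //; apply/eqP; rewrite eqn_leq Xk.
  by rewrite -subn_eq0 hm.
have [l lZ lX] : exists2 l, l \in Z & l \notin X.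
  apply/fintype.subsetPn; apply: contraTN kZ => ZX.
  by rewrite -ltnNge (leq_ltn_trans (subset_leq_card ZX)) // -subn_gt0 hm.
have [||| B [sB BZ cB]] := IH (l |: X)%SET.
- by rewrite cardsU1 lX add1n subnS hm.
- by rewrite finset.subUset finset.sub1set lZ XZ.
- by rewrite cardsU1 lX add1n -subn_gt0 hm.
by exists B; split=> //; apply: fintype.subset_trans sB; exact: finset.subsetUr.
Qed.

Section Geometry.
Variables (R : realType) (n : nat) (P : simple_planes R n).
Implicit Types (x y z d : 'rV[R]_3) (A B : {set 'I_n}) (i j k l : 'I_n).
Implicit Types (s : signs n) (f : 'cV[R]_3).

Definition slope i d : R := dot d (normal P i).

Definition height i x : R := slope i x - offset P i.

Definition zeros x : {set 'I_n} := [set i | height i x == 0]%SET.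

(** [x] lies in the closed cell of [s]; the signs of the planes through [x]
are unconstrained. *)
Definition incident x s : bool := [forall i, 0 <= sg R (s i) * height i x].

Definition in_cell s x : bool := [forall i, 0 < sg R (s i) * height i x].

Definition realized s : bool := `[< exists x, in_cell s x >].

Lemma heightD i x d : height i (x + d) = height i x + slope i d.
Proof. by rewrite /height /slope dotD; ring. Qed.

Lemma heightZ i x t d : height i (x + t *: d) = height i x + t * slope i d.
Proof. by rewrite heightD /slope dotZ. Qed.

Lemma slopeB i x y : slope i (x - y) = height i x - height i y.
Proof. by rewrite /height /slope dotB; ring. Qed.

Lemma height_seg i x y t :
  height i (x + t *: (y - x)) = (1 - t) * height i x + t * height i y.
Proof. by rewrite heightZ slopeB; ring. Qed.

Lemma dual_ex A i : #|A| = 3%N -> i \in A ->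
  exists d, forall j, j \in A -> slope j d = (j == i)%:R.
Proof.
move=> cA iA.
pose t (k : 'I_3) : 'I_n := enum_val (cast_ord (esym cA) k).
pose N : 'M[R]_3 := \matrix_(r, q) normal P (t q) r 0.
have NE (x : 'rV[R]_3) q : (x *m N) 0 q = dot x (normal P (t q)).
  by rewrite /dot !mxE; apply: eq_bigr => r _; rewrite mxE.
have tA q : t q \in A by exact: enum_valP.
have tK j : j \in A -> exists q, t q = j.
  move=> jA; exists (cast_ord cA (enum_rank_in jA j)).
  by rewrite /t cast_ordK enum_rankK_in.
have Nu : N \in unitmx.
  rewrite -row_free_unit; apply: inj_row_free => v vN.
  apply: (normals_free (s := P) cA) => j /tK[q <-].
  by rewrite -NE vN mxE.
have [q0 q0i] := tK _ iA.
exists (delta_mx 0 q0 *m invmx N) => j /tK[q <-].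
rewrite /slope -NE mulmxKV // mxE eqxx /= -q0i.
congr (_%:R); congr nat_of_bool; apply/eqP/eqP => [->//|].
by move/enum_val_inj/cast_ord_inj.
Qed.

(** The basis dual to the three normals of [A]; its vector [i] directs the line in
which the two other planes meet. *)
Definition dual A i : 'rV[R]_3 :=
  xget 0 [set d | forall j, j \in A -> slope j d = (j == i)%:R].

Definition vertex A : 'rV[R]_3 := \sum_(i in A) offset P i *: dual A i.

Lemma slope_dual A i j : #|A| = 3%N -> i \in A -> j \in A ->
  slope j (dual A i) = (j == i)%:R.
Proof.
move=> cA iA; rewrite /dual; case: xgetP => [d _ /(_ j)//|/(_ _ _)].
by case: (dual_ex cA iA) => d hd /(_ d).
Qed.

Lemma slope_sum (I : Type) (r : seq I) (Q : pred I) (F : I -> 'rV[R]_3) j :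
  slope j (\sum_(i <- r | Q i) F i) = \sum_(i <- r | Q i) slope j (F i).
Proof. exact: dot_sum. Qed.

Lemma slope_dual_sum A (u : 'I_n -> R) j : #|A| = 3%N -> j \in A ->
  slope j (\sum_(i in A) u i *: dual A i) = u j.
Proof.
move=> cA jA; rewrite slope_sum (bigD1 j) //= big1 ?addr0.
  by rewrite /slope dotZ [dot _ _]slope_dual // eqxx mulr1.
move=> i /andP[iA ij]; rewrite /slope dotZ [dot _ _]slope_dual //.
by rewrite eq_sym (negPf ij) mulr0.
Qed.

Lemma height_vertex A i : #|A| = 3%N -> i \in A -> height i (vertex A) = 0.
Proof. by move=> cA iA; rewrite /height slope_dual_sum // subrr. Qed.

Lemma dual_decomp A d : #|A| = 3%N -> d = \sum_(i in A) slope i d *: dual A i.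
Proof.
move=> cA; apply/eqP; rewrite -subr_eq0; apply/eqP.
apply: (normals_free (s := P) cA) => i iA.
by rewrite dotB -/(slope i _) -/(slope i (\sum_(j in A) _)) slope_dual_sum // subrr.
Qed.

Lemma vertex_decomp A x : #|A| = 3%N ->
  x = vertex A + \sum_(i in A) height i x *: dual A i.
Proof.
move=> cA; apply: (addrI (- vertex A)); rewrite addKr addrC.
rewrite [LHS](dual_decomp _ cA).
by apply: eq_bigr => i iA; rewrite slopeB height_vertex // subr0.
Qed.

Lemma card_zeros x : (#|zeros x| <= 3)%N.
Proof.
rewrite leqNgt; apply/negP => h4.
have [B cB sB] : exists2 B : {set 'I_n}, #|B| = 4%N & B \subset zeros x.
  have /card_gt0P[B] : (0 < #|[set B : {set 'I_n} | B \subset zeros x & #|B| == 4%N]|)%N.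
    by rewrite cards_draws bin_gt0.
  by rewrite inE => /andP[sB /eqP cB]; exists B.
apply: (no_four_concur (s := P) (x := x) cB) => i /(fintype.subsetP sB).
by rewrite inE /height subr_eq0 => /eqP.
Qed.

Lemma zeros_vertex A : #|A| = 3%N -> zeros (vertex A) = A.
Proof.
move=> cA; apply/esym/eqP; rewrite eqEcard cA card_zeros andbT.
by apply/fintype.subsetP => i iA; rewrite inE height_vertex.
Qed.

Lemma vertex_unique A x : #|A| = 3%N -> A \subset zeros x -> x = vertex A.
Proof.
move=> cA sA; rewrite [LHS](vertex_decomp x cA) big1 ?addr0 // => i iA.
by have := fintype.subsetP sA _ iA; rewrite inE => /eqP ->; rewrite scale0r.
Qed.

Lemma height_vertex_neq0 A i : #|A| = 3%N -> i \notin A -> height i (vertex A) != 0.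
Proof. by move=> cA; rewrite -{1}(zeros_vertex cA) inE. Qed.

Lemma incidentP x s :
  reflect (forall i, 0 <= sg R (s i) * height i x) (incident x s).
Proof. exact: forallP. Qed.

Lemma in_cellP s x :
  reflect (forall i, 0 < sg R (s i) * height i x) (in_cell s x).
Proof. exact: forallP. Qed.

Lemma in_cell_incident s x : in_cell s x -> incident x s.
Proof. by move/in_cellP => h; apply/incidentP => i; exact: ltW. Qed.

Lemma incident_sign x s i : incident x s -> height i x != 0 ->
  0 < sg R (s i) * height i x.
Proof.
by move=> /incidentP/(_ i) h h0; rewrite lt_neqAle h eq_sym mulf_neq0 ?sg_neq0.
Qed.

Lemma incident_eq x s s' i : incident x s -> incident x s' -> height i x != 0 ->
  s i = s' i.
Proof.
by move=> hs hs' h0; apply: sg_pos_eq (incident_sign hs h0) (incident_sign hs' h0).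
Qed.

(** Choose a direction along the planes through [x] that is transversal to a
further plane, and go to the nearest plane met, ahead or behind: the sign of
a plane cannot be reversed before that plane is reached. *)
Lemma push x : (#|zeros x| < 3)%N ->
  exists2 y, zeros x \proper zeros y & forall s, incident x s -> incident y s.
Proof.
move=> c3.
have [l lx] : exists l, l \notin zeros x.
  have : (0 < #|~: zeros x|)%N.
    rewrite cardsCs finset.setCK card_ord subn_gt0 (leq_trans c3) //.
    exact: (three_planes P).
  by case/card_gt0P => l; rewrite inE => lX; exists l.
have [||| B [sB _ cB]] := @subset_between _ (l |: zeros x)%SET [set: 'I_n]%SET 3%N.
- exact: finset.subsetT.
- by rewrite cardsU1 lx.
- by rewrite cardsT card_ord (three_planes P).
have lB : l \in B by rewrite (fintype.subsetP sB) // !inE eqxx.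
pose d := dual B l.
have dl : slope l d != 0 by rewrite slope_dual // eqxx oner_eq0.
have dz i : i \in zeros x -> slope i d = 0.
  move=> ix; rewrite slope_dual //; last by rewrite (fintype.subsetP sB) // inE ix orbT.
  by case: eqP ix lx => // -> ->.
pose t i := - height i x / slope i d.
have [m dm mmin] : exists2 m, slope m d != 0 &
    forall j, slope j d != 0 -> `|t m| <= `|t j|.
  case: (@arg_minP _ R _ l (fun i => slope i d != 0) (fun i => `|t i|) dl) => m hm hmin.
  by exists m.
have hm0 : height m (x + t m *: d) = 0.
  by rewrite heightZ /t divfK // addrN.
exists (x + t m *: d).
  apply/fintype.properP; split.
    apply/fintype.subsetP => i ix; rewrite inE heightZ dz // mulr0 addr0.
    by move: ix; rewrite inE.
  exists m; first by rewrite inE hm0.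
  by apply: contra dm => /dz ->.
move=> s /incidentP hs; apply/incidentP => i.
have [di|di] := eqVneq (slope i d) 0; first by rewrite heightZ di mulr0 addr0.
have hi : `|t m * slope i d| <= sg R (s i) * height i x.
  have -> : sg R (s i) * height i x = `|t i * slope i d|.
    rewrite /t divfK // normrN -[LHS]ger0_norm // normrM.
    by case: (s i); rewrite /sg ?normrN normr1 mul1r.
  by rewrite (normrM (t m)) (normrM (t i)); apply: ler_wpM2r => //; exact: mmin.
rewrite heightZ mulrDr; set v := t m * _ in hi *.
have : - v <= `|v| by rewrite -normrN ler_norm.
have : v <= `|v| by rewrite ler_norm.
by case: (s i) hi; rewrite /sg; lra.
Qed.

(** A closed cell contains no line, because three normals always span the
space; so moving inside it until new planes are met ends at a vertex. *)
Lemma push_vertex x : exists A, [/\ #|A| = 3%N, zeros x \subset A &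
  forall s, incident x s -> incident (vertex A) s].
Proof.
elim: {x}(3 - #|zeros x|)%N {-2}x (leqnn (3 - #|zeros x|)%N) => [|m IH] x.
  rewrite leqn0 subn_eq0 => h; exists (zeros x).
  have c3 : #|zeros x| = 3%N by apply/eqP; rewrite eqn_leq h card_zeros.
  by split=> // s; rewrite -(@vertex_unique _ x c3).
case: (ltnP #|zeros x| 3) => [c3 hm|c3 _]; last first.
  by apply: IH; rewrite (eqP (_ : 3 - _ == 0)%N) ?subn_eq0.
have [y pxy hy] := push c3.
have [|A [cA yA hA]] := IH y.
  move: (proper_card pxy) hm => h1 h2.
  by rewrite -ltnS; apply: leq_trans h2; apply: ltn_sub2l.
exists A; split=> //; first by apply: fintype.subset_trans yA; exact: fintype.proper_sub.
by move=> s /hy/hA.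
Qed.

(** Each flat through a vertex carries, arbitrarily close to it, points that lie
strictly on the side [s] of all the planes not containing the flat. *)
Lemma near_vertex A s (Y : {set 'I_n}) : #|A| = 3%N -> Y \subset A ->
  incident (vertex A) s ->
  exists2 e0 : R, 0 < e0 & forall e : R, 0 < e -> e <= e0 ->
    let z := vertex A + e *: \sum_(k in A | k \notin Y) sg R (s k) *: dual A k in
    (forall i, i \in Y -> height i z = 0) /\
    (forall i, i \notin Y -> 0 < sg R (s i) * height i z).
Proof.
move=> cA sY hs.
pose w := \sum_(k in A | k \notin Y) sg R (s k) *: dual A k.
have wA i : i \in A -> slope i w = if i \in Y then 0 else sg R (s i).
  move=> iA; have -> : w = \sum_(k in A) (if k \in Y then 0 else sg R (s k)) *: dual A k.
    rewrite /w big_mkcondr; apply: eq_bigr => k _.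
    by case: (k \in Y); rewrite //= scale0r.
  by rewrite slope_dual_sum.
have [d0 d00 hd] := @small_step R _ (fun i => i \notin A)
  (fun i => sg R (s i) * height i (vertex A)) (fun i => sg R (s i) * slope i w)
  (fun i iA => incident_sign hs (height_vertex_neq0 cA iA)).
exists d0 => // d dpos dd0 /=; rewrite -/w; split=> i iY.
  have iA := fintype.subsetP sY _ iY.
  by rewrite heightZ height_vertex // wA // iY mulr0 addr0.
case iA: (i \in A); last first.
  have := hd d i dpos dd0; rewrite iA => /(_ isT) h0.
  by rewrite heightZ mulrDr (mulrCA (sg R (s i))).
rewrite heightZ height_vertex // wA // (negPf iY) add0r mulrCA sg_sq mulr1 //.
Qed.

Lemma incident_vertex_realized A s : #|A| = 3%N -> incident (vertex A) s -> realized s.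
Proof.
move=> cA hs; have [d0 d00 /(_ d0 d00 (lexx _)) /= [_ hz]] :=
  near_vertex cA (finset.sub0set _) hs.
by apply/asboolP; eexists; apply/in_cellP => i; apply: hz; rewrite finset.in_set0.
Qed.

Lemma incident_realized x s : incident x s -> realized s.
Proof.
have [A [cA _ hA]] := push_vertex x.
by move/hA; exact: incident_vertex_realized.
Qed.

End Geometry.

(** * Orientation by a generic functional *)

(** On the moment curve [t -> (1, t, t^2)] each nonzero vector gives a
nonzero polynomial in [t], and a product of nonzero polynomials has a
non-root. *)
Lemma generic_functional (R : realType) (I : finType) (Q : pred I) (d : I -> 'rV[R]_3) :
  (forall i, Q i -> d i != 0) -> exists f, forall i, Q i -> dot (d i) f != 0.
Proof.
move=> hd.
pose p i : {poly R} := \poly_(r < 3) (d i 0 (inord r)).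
have pE i t : (p i).[t] = dot (d i) (\col_r t ^+ r).
  rewrite horner_poly /dot mxE; apply: eq_bigr => r _.
  by rewrite mxE inord_val.
have p0 i : Q i -> p i != 0.
  move/hd; apply: contraNneq => pi0; apply/eqP/rowP => r.
  have := coef_poly 3 (fun r => d i 0 (inord r)) r.
  by rewrite -/(p i) pi0 coef0 ltn_ord inord_val mxE => ->.
pose q := \prod_(i | Q i) p i.
have q0 : q != 0 by apply/prodf_neq0 => i /p0.
pose rs : seq R := [seq k%:R | k <- iota 0 (size q)].
have urs : uniq rs by rewrite map_inj_uniq ?iota_uniq //; exact: mulrIn (oner_neq0 _).
have : ~~ all (root q) rs.
  apply/negP => hall; have := max_poly_roots q0 hall urs.
  by rewrite size_map size_iota ltnn.
case/allPn => t _; rewrite rootE horner_prod => /prodf_neq0 ht.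
by exists (\col_r t ^+ r) => i Qi; rewrite -pE; exact: ht.
Qed.

Section Flip.
Variable n : nat.
Implicit Types (s : signs n) (i j : 'I_n).

Definition flip i s : signs n := [ffun j => if j == i then ~~ s j else s j].

Lemma flipE i s j : flip i s j = if j == i then ~~ s j else s j.
Proof. by rewrite ffunE. Qed.

Lemma flip_id i s : flip i s i = ~~ s i.
Proof. by rewrite ffunE eqxx. Qed.

Lemma flip_neq i j s : j != i -> flip i s j = s j.
Proof. by rewrite ffunE => /negPf ->. Qed.

Lemma flipK i : involutive (flip i).
Proof. by move=> s; apply/ffunP => j; rewrite !ffunE; case: eqP => // _; rewrite negbK. Qed.

Lemma flip_or i s s' : (forall j, j != i -> s j = s' j) -> s = s' \/ s = flip i s'.
Proof.
move=> h; have [e|e] := eqVneq (s i) (s' i).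
  by left; apply/ffunP => j; have [->|/h] := eqVneq j i.
right; apply/ffunP => j; have [->|ji] := eqVneq j i; last by rewrite flip_neq // h.
by rewrite flip_id; case: (s i) (s' i) e => [] [].
Qed.

End Flip.

Section Orientation.
Variables (R : realType) (n : nat) (P : simple_planes R n).
Implicit Types (x y z d : 'rV[R]_3) (A B : {set 'I_n}) (i j k l : 'I_n).
Implicit Types (s : signs n) (f : 'cV[R]_3).

(** [f] is constant along no line of the arrangement. *)
Definition generic f : Prop :=
  forall A i, #|A| = 3%N -> i \in A -> dot (dual P A i) f != 0.

Lemma generic_ex : exists f, generic f.
Proof.
have [|f hf] := @generic_functional R ({set 'I_n} * 'I_n)%type
  (fun e => (#|e.1| == 3%N) && (e.2 \in e.1)) (fun e => dual P e.1 e.2).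
  move=> [A i] /= /andP[/eqP cA iA]; apply/eqP => d0.
  have := slope_dual P cA iA iA; rewrite d0 eqxx /slope /dot mul0mx mxE.
  by move/eqP; rewrite eq_sym oner_eq0.
by exists f => A i cA iA; apply: (hf (A, i)); rewrite /= cA eqxx.
Qed.

Lemma genericN f : generic f -> generic (- f).
Proof. by move=> hf A i cA iA; rewrite dotNr oppr_eq0 hf. Qed.

(** The chamber at [vertex A] on which [f] is minimal at that vertex. *)
Definition upper f A : signs n :=
  [ffun i => if i \in A then 0 < dot (dual P A i) f else 0 < height P i (vertex P A)].

Lemma upper_incident f A : #|A| = 3%N -> incident P (vertex P A) (upper f A).
Proof.
move=> cA; apply/incidentP => i; rewrite ffunE.
case: ifP => [iA|/negbT iA]; first by rewrite height_vertex // mulr0.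
by rewrite ltW // sg_pos // height_vertex_neq0.
Qed.

Lemma upper_sign f A i : generic f -> #|A| = 3%N -> i \in A ->
  0 < sg R (upper f A i) * dot (dual P A i) f.
Proof. by move=> hf cA iA; rewrite ffunE iA sg_pos // hf. Qed.

Lemma upperN f A i : generic f -> #|A| = 3%N ->
  upper (- f) A i = (i \in A) (+) upper f A i.
Proof.
move=> hf cA; rewrite !ffunE; case: ifP => //= iA.
rewrite dotNr oppr_gt0; case: ltrgtP (hf A i cA iA) => //.
Qed.

Lemma functional_decomp f A x : #|A| = 3%N ->
  dot x f = dot (vertex P A) f + \sum_(i in A) height P i x * dot (dual P A i) f.
Proof.
move=> cA; rewrite {1}(vertex_decomp P x cA) dotD; congr (_ + _).
by rewrite dot_sum; apply: eq_bigr => i _; rewrite dotZ.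
Qed.

(** In the dual coordinates at the vertex of [A], the functional [f] is a
combination of the three heights with coefficients of signs [upper f A], so each
plane of [A] that misses the vertex of [B] contributes a positive amount. Hence
the closed cell of [upper f A], or a face of it spanned by edges that leave the
vertex upwards, has this vertex as its only lowest point. *)
Lemma upper_lt f A B s : generic f -> #|A| = 3%N -> #|B| = 3%N -> A != B ->
  incident P (vertex P B) s ->
  (forall l, l \in A -> l \notin B -> s l = upper f A l) ->
  dot (vertex P A) f < dot (vertex P B) f.
Proof.
move=> hf cA cB AB hs hl; rewrite (functional_decomp f (vertex P B) cA) ltrDl.
have term l : l \in A -> l \notin B -> 0 < height P l (vertex P B) * dot (dual P A l) f.
  move=> lA lB; have := incident_sign hs (height_vertex_neq0 P cB lB).
  have := upper_sign hf cA lA; rewrite hl //.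
  by case: (upper f A l); rewrite /sg => h1 h2; nra.
have [l lA lB] : exists2 l, l \in A & l \notin B.
  apply/fintype.subsetPn; apply: contra AB => sAB.
  by rewrite eqEcard sAB cA cB.
rewrite (bigD1 l) //= ltr_wpDr ?term // sumr_ge0 // => k /andP[kA _].
have [kB|kB] := boolP (k \in B); first by rewrite height_vertex // mul0r.
by rewrite ltW // term.
Qed.

Lemma upper_face_unique f A B s i : generic f -> #|A| = 3%N -> #|B| = 3%N ->
  i \in A -> i \in B -> incident P (vertex P A) s -> incident P (vertex P B) s ->
  (forall l, l != i -> s l = upper f A l) ->
  (forall l, l != i -> s l = upper f B l) -> A = B.
Proof.
move=> hf cA cB iA iB sA sB hA hB; apply/eqP; apply/negPn/negP => AB.
have h1 : dot (vertex P A) f < dot (vertex P B) f.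
  apply: (upper_lt hf cA cB AB sB) => l lA lB; apply: hA.
  by apply: contraNneq lB => ->.
have h2 : dot (vertex P B) f < dot (vertex P A) f.
  rewrite eq_sym in AB.
  apply: (upper_lt hf cB cA AB sA) => l lA lB; apply: hB.
  by apply: contraNneq lB => ->.
by have := lt_trans h1 h2; rewrite ltxx.
Qed.

Lemma upper_inj f A B : generic f -> #|A| = 3%N -> #|B| = 3%N ->
  upper f A = upper f B -> A = B.
Proof.
move=> hf cA cB e; apply/eqP; apply/negPn/negP => AB.
have h1 : dot (vertex P A) f < dot (vertex P B) f.
  by apply: (upper_lt hf cA cB AB (upper_incident f cB)) => l _ _; rewrite e.
have h2 : dot (vertex P B) f < dot (vertex P A) f.
  rewrite eq_sym in AB.
  by apply: (upper_lt hf cB cA AB (upper_incident f cA)) => l _ _; rewrite e.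
by have := lt_trans h1 h2; rewrite ltxx.
Qed.

Lemma incident_flip A s i : #|A| = 3%N -> i \in A ->
  incident P (vertex P A) s -> incident P (vertex P A) (flip i s).
Proof.
move=> cA iA /incidentP hs; apply/incidentP => j.
have [->|ji] := eqVneq j i; first by rewrite height_vertex // mulr0.
by rewrite flip_neq.
Qed.

Lemma incident_off A s s' l : #|A| = 3%N -> incident P (vertex P A) s ->
  incident P (vertex P A) s' -> l \notin A -> s l = s' l.
Proof. by move=> cA hs hs' lA; apply: incident_eq hs hs' _; rewrite height_vertex_neq0. Qed.

(** Of three signs, either at most one differs from the upper chamber or at most
one differs from the chamber opposite to it, which is the upper one for [- f]. *)
Lemma star_cover f A s : generic f -> #|A| = 3%N -> incident P (vertex P A) s ->
  exists2 g, g = f \/ g = - f &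
    s = upper g A \/ exists2 k, k \in A & s = flip k (upper g A).
Proof.
move=> hf cA hs.
have offE g l : l \notin A -> s l = upper g A l.
  by move=> lA; apply: incident_off hs (upper_incident g cA) lA.
have small g : (#|[set l in A | s l != upper g A l]| <= 1)%N ->
    s = upper g A \/ exists2 k, k \in A & s = flip k (upper g A).
  rewrite leq_eqVlt => /orP[/cards1P[k hk]|].
    have : k \in [set k]%SET by rewrite inE.
    rewrite -hk inE => /andP[kA nk]; right; exists k => //.
    apply/ffunP => l; have [->|lk] := eqVneq l k.
      by rewrite flip_id; case: (s k) (upper g A k) nk => [] [].
    rewrite flip_neq //; have [lA|/(offE g)->//] := boolP (l \in A).
    have : l \notin [set k]%SET by rewrite inE.
    by rewrite -hk inE lA negbK => /eqP.
  rewrite ltnS leqn0 cards_eq0 => /eqP h; left; apply/ffunP => l.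
  have [lA|/(offE g)->//] := boolP (l \in A).
  have : l \notin (finset.set0 : {set 'I_n}) by rewrite inE.
  by rewrite -h inE lA negbK => /eqP.
have [c1|c1] := leqP #|[set l in A | s l != upper f A l]| 1.
  by exists f; [left|exact: small].
exists (- f); [by right|apply: small].
have -> : [set l in A | s l != upper (- f) A l]%SET =
    A :\: [set l in A | s l != upper f A l]%SET.
  apply/setP => l; rewrite !inE; case lA: (l \in A) => //=.
  by rewrite upperN // lA /=; case: (s l); case: (upper f A l).
rewrite cardsD (finset.setIidPr _); last by apply/fintype.subsetP => l; rewrite inE => /andP[].
by rewrite cA leq_subLR addn1.
Qed.

End Orientation.

(** * Lines, rays and their upper ends *)

Lemma opposite_terms (R : realType) (a b c e : R) : 0 < b -> 0 < e ->
  a * b + c * e = 0 -> ~ (a = 0 /\ c = 0) -> (0 < a) = (0 < c) -> False.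
Proof.
move=> b0 e0 h nz hc; have [a0|a0|a0] := ltrgtP 0 a.
- by move: hc h; rewrite a0 => /esym c0 h; nra.
- by move: hc; rewrite ltNge (ltW a0) /= => /esym/negbT; rewrite -leNgt => c0; nra.
- move: h; rewrite -a0 mul0r add0r => /eqP; rewrite mulf_eq0 (gt_eqF e0) orbF => /eqP c0.
  by apply: nz.
Qed.

Section Rays.
Variables (R : realType) (n : nat) (P : simple_planes R n).
Implicit Types (x y z d : 'rV[R]_3) (A B : {set 'I_n}) (i j k l : 'I_n).
Implicit Types (s : signs n) (f : 'cV[R]_3).

Lemma card_swap A k l : #|A| = 3%N -> k \in A -> l \notin A -> #|l |: A :\ k| = 3%N.
Proof.
move=> cA kA lA; rewrite cardsU1 !inE (negPf lA) andbF /=.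
by move: (cardsD1 k A); rewrite kA cA add1n => -[<-].
Qed.

Lemma on_line A k x : #|A| = 3%N -> k \in A -> A :\ k \subset zeros P x ->
  x = vertex P A + height P k x *: dual P A k.
Proof.
move=> cA kA sx; rewrite {1}(vertex_decomp P x cA) (bigD1 k) //= big1 ?addr0 //.
move=> i /andP[iA ik]; have : i \in zeros P x.
  by rewrite (fintype.subsetP sx) // !inE ik.
by rewrite inE => /eqP ->; rewrite scale0r.
Qed.

Lemma height_on_line A k x f : #|A| = 3%N -> k \in A -> A :\ k \subset zeros P x ->
  dot x f = dot (vertex P A) f + height P k x * dot (dual P A k) f.
Proof. by move=> cA kA sx; rewrite {1}(on_line cA kA sx) dotD dotZ. Qed.

Lemma swap_zeros A k l : #|A| = 3%N -> k \in A -> l \notin A ->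
  A :\ k \subset zeros P (vertex P (l |: A :\ k)).
Proof.
move=> cA kA lA; rewrite zeros_vertex ?card_swap //; exact: finset.subsetUr.
Qed.

(** Following the line through the vertex of [A] off plane [k], in the upward
direction, one meets a next vertex or reaches the end of the line. At the end
the signs are those of the upper cells of all the vertices of the line. *)
Lemma next_vertex f A k s : generic P f -> #|A| = 3%N -> k \in A ->
  incident P (vertex P A) s -> s k = upper P f A k ->
  (exists2 l, l \notin A & incident P (vertex P (l |: A :\ k)) s) \/
  (forall l, l \notin A -> s l = upper P f (l |: A :\ k) l).
Proof.
move=> hf cA kA hs sk.
pose q l := vertex P (l |: A :\ k).
pose t l := sg R (s k) * height P k (q l).
have kq l : l \notin A -> k \notin l |: A :\ k.
  by move=> lA; rewrite !inE eqxx orbF; apply: contraNneq lA => <-.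
have t0 l : l \notin A -> t l != 0.
  by move=> lA; rewrite mulf_neq0 ?sg_neq0 // height_vertex_neq0 ?card_swap ?kq.
case: (pickP (fun l => (l \notin A) && (0 < t l))) => [l0 hl0|hno].
  left.
  case: (@arg_minP _ R _ l0 (fun l => (l \notin A) && (0 < t l)) t hl0)
    => l /andP[lA tl] lmin.
  exists l => //; apply/incidentP => m.
  have [mA|mA] := boolP (m \in l |: A :\ k).
    by rewrite height_vertex ?mulr0 // card_swap.
  have [->|mk] := eqVneq m k; first exact: ltW.
  have mA' : m \notin A.
    by apply: contra mA => mA; rewrite !inE mk mA orbT.
  have ml : m != l by apply: contraNneq mA => ->; rewrite !inE eqxx.
  rewrite leNgt; apply/negP => hneg.
  have hA := incident_sign hs (height_vertex_neq0 P cA mA').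
  have qm := height_vertex P (card_swap cA kA mA') (setU11 m _).
  have ql := on_line cA kA (swap_zeros cA kA lA).
  have qm' := on_line cA kA (swap_zeros cA kA mA').
  move: qm hneg; rewrite -/(q m) -/(q l) in ql qm' *.
  rewrite ql qm' !heightZ => qm.
  set h0 := height P m (vertex P A) in hA qm *.
  set D := slope P m _ in qm *.
  have tlE : height P k (q l) = sg R (s k) * t l by rewrite mulrA sg_sq mul1r.
  have tmE : height P k (q m) = sg R (s k) * t m by rewrite mulrA sg_sq mul1r.
  rewrite tlE; rewrite tmE in qm.
  set e := sg R (s m) in hA *; set c := sg R (s k) in qm *.
  (* [t m] would be a smaller positive time *)
  have e1 : e * h0 + t m * (e * c * D) = 0.
    by rewrite -[RHS](mulr0 e) -qm; ring.
  move=> hneg.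
  have e2 : e * h0 + t l * (e * c * D) < 0 by move: hneg; congr (_ < 0); ring.
  have hD : e * c * D < 0.
    by rewrite ltNge; apply/negP => hD; have := mulr_ge0 (ltW tl) hD; lra.
  have tm : 0 < t m.
    rewrite ltNge; apply/negP => htm.
    have := mulr_le0 htm (ltW hD); lra.
  have := lmin m; rewrite mA' tm => /(_ isT) tlm.
  by have := ler_wnM2r (ltW hD) tlm; lra.
right=> l lA.
have tl : t l < 0.
  by have := hno l; rewrite lA /= => /negbT; rewrite -leNgt le_eqVlt (negPf (t0 l lA)).
have cl := card_swap cA kA lA.
have zl : (l |: A :\ k) :\ l = A :\ k.
  by rewrite setU1K // !inE (negPf lA) andbF.
have e1 := height_on_line f cA kA (swap_zeros cA kA lA).
have e2 : dot (vertex P A) f = dot (q l) f +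
    height P l (vertex P A) * dot (dual P (l |: A :\ k) l) f.
  apply: height_on_line => //; first exact: setU11.
  by rewrite zl zeros_vertex // finset.subsetDl.
have h1 := incident_sign hs (height_vertex_neq0 P cA lA).
have h2 := upper_sign hf cl (setU11 l _).
have h3 := upper_sign hf cA kA; rewrite -sk in h3.
rewrite -/(q l) in e1.
have {e1 e2} : height P k (q l) * dot (dual P A k) f +
   height P l (vertex P A) * dot (dual P (l |: A :\ k) l) f = 0 by lra.
move: tl h1 h2 h3; rewrite /t.
move: (height P k (q l)) (dot (dual P A k) f) (height P l (vertex P A))
  (dot (dual P (l |: A :\ k) l) f).
move=> a b c d; rewrite -/(q l).
by case: (s k); case: (s l); case: (upper P f _ l); rewrite /sg // => h1 h2 h3 h4; nra.
Qed.

(** The chambers around the upper end of the line of planes [i] and [j]. *)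
Definition top f s i j : Prop :=
  forall l, l != i -> l != j -> s l = upper P f [set i; j; l]%SET l.

Lemma axis_ex f j : exists2 d : 'rV[R]_3, d != 0 & slope P j d = 0 /\ dot d f = 0.
Proof.
pose M : 'M[R]_(3, 1 + 1) := row_mx (normal P j) f.
have kM : kermx M != 0.
  rewrite kermx_eq0 /row_free; apply/eqP => rM.
  by have := rank_leq_col M; rewrite rM.
have : (nz_row (kermx M) <= kermx M)%MS by exact: nz_row_sub.
move/sub_kermxP; rewrite mul_mx_row => h.
exists (nz_row (kermx M)); first by rewrite nz_row_eq0.
have := congr1 lsubmx h; have := congr1 rsubmx h; rewrite row_mxKl row_mxKr => h1 h2.
by rewrite /slope /dot h1 h2 !mxE.
Qed.

(** A horizontal direction of plane [j], where [f] measures altitude. *)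
Definition axis f j : 'rV[R]_3 :=
  xget 0 [set d | d != 0 /\ slope P j d = 0 /\ dot d f = 0].

(** On which side of plane [i], along the horizontal direction of plane [j], the
cell of [s] lies: it distinguishes a left edge of a face from a right one. *)
Definition side f j s i : bool := 0 < sg R (s i) * slope P i (axis f j).

(** In plane [j] an unbounded face has at most two edges that go to infinity
upwards, its leftmost and its rightmost one. Indeed two such edges, on planes
[i1] and [i2], make [f] on plane [j] a positive combination of the two heights
taken on the side of the face, and these are opposite along the axis. *)
Lemma top_side f s j i1 i2 : generic P f -> i1 != j -> i2 != j ->
  top f s i1 j -> top f s i2 j -> side f j s i1 = side f j s i2 -> i1 = i2.
Proof.
move=> hf i1j i2j h1 h2 hside; apply/eqP; apply/negPn/negP => i12.
pose B := [set i1; j; i2]%SET.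
have cB : #|B| = 3%N by rewrite /B finset.setUC cardsU1 !inE cards2 negb_or eq_sym i12 i2j i1j.
have i1B : i1 \in B by rewrite !inE eqxx.
have i2B : i2 \in B by rewrite !inE eqxx !orbT.
have jB : j \in B by rewrite !inE eqxx !orbT.
have s2 : s i2 = upper P f B i2 by apply: h1; rewrite // eq_sym.
have s1 : s i1 = upper P f B i1.
  by rewrite h2 //; congr (upper P f _ i1); apply/setP => l; rewrite !inE; do !case: eqP.
have [d0 [dj df]] : axis f j != 0 /\ slope P j (axis f j) = 0 /\ dot (axis f j) f = 0.
  rewrite /axis; case: xgetP => [d _ //|h].
  by have [d d0 hd] := axis_ex f j; case: (h d).
move: hside; rewrite /side; move: (axis f j) d0 dj df => d d0 dj df.
have dE := dual_decomp P d cB.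
have BE (F : 'I_n -> 'rV[R]_3) : \sum_(i in B) F i = F i1 + F j + F i2.
  rewrite (bigD1 i1) //= (bigD1 j) /=; last by rewrite jB eq_sym i1j.
  rewrite (bigD1 i2) /=; last by rewrite i2B eq_sym i12 i2j.
  rewrite big1 ?addr0 ?addrA // => i; rewrite !inE.
  by do !case: eqP => //=.
have fE : slope P i1 d * dot (dual P B i1) f + slope P i2 d * dot (dual P B i2) f = 0.
  move: df; rewrite [d in dot d f]dE BE dj scale0r addr0 dotD !dotZ //.
have p1 := upper_sign hf cB i1B; have p2 := upper_sign hf cB i2B.
rewrite -s1 in p1; rewrite -s2 in p2.
have nz : ~ (slope P i1 d = 0 /\ slope P i2 d = 0).
  case=> z1 z2; move/eqP: d0; apply.
  by rewrite dE BE z1 z2 dj !scale0r !addr0.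
move: fE p1 p2 nz.
move: (slope P i1 d) (dot (dual P B i1) f) (slope P i2 d) (dot (dual P B i2) f).
move=> a b c e h hb he nz hside.
apply: (@opposite_terms R (sg R (s i1) * a) (sg R (s i1) * b)
  (sg R (s i2) * c) (sg R (s i2) * e)) => //.
  by rewrite mulrACA sg_sq mul1r mulrACA sg_sq mul1r.
case=> /eqP; rewrite mulf_eq0 (negPf (sg_neq0 _ _)) /= => /eqP a0 /eqP.
by rewrite mulf_eq0 (negPf (sg_neq0 _ _)) /= => /eqP c0; apply: nz.
Qed.

Lemma triple_set A i k : #|A| = 3%N -> i \in A -> k \in A -> i != k ->
  exists j, [/\ j != i, j != k & A = [set i; j; k]%SET].
Proof.
move=> cA iA kA ik.
have : #|A :\ i :\ k| = 1%N.
  move: (cardsD1 i A) (cardsD1 k (A :\ i)); rewrite iA cA !inE kA eq_sym ik /=.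
  by rewrite !add1n => -[<-] [<-].
move/eqP/cards1P => [j hj]; have : j \in [set j]%SET by rewrite inE.
rewrite -hj !inE => /and3P[jk ji jA]; exists j; split=> //.
apply/esym/eqP; rewrite eqEcard; apply/andP; split.
  by apply/fintype.subsetP => l; rewrite !inE -orbA => /or3P[]/eqP->.
by rewrite cA finset.setUC cardsU1 !inE cards2 negb_or !(eq_sym k) jk ik (eq_sym i) ji.
Qed.

Lemma other_member A i : #|A| = 3%N -> i \in A -> exists2 k, k \in A & k != i.
Proof.
move=> cA iA; have : (0 < #|A :\ i|)%N by move: (cardsD1 i A); rewrite iA cA add1n => -[<-].
by case/card_gt0P => k; rewrite !inE => /andP[? ?]; exists k.
Qed.

(** If each vertex of a face is its lowest or its highest one, the face has at
most one highest vertex to go to, so one of the two edges leaving its lowest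
vertex is a ray. *)
Lemma ray_edge f A s i : generic P f -> #|A| = 3%N -> i \in A ->
  incident P (vertex P A) s -> (forall l, l != i -> s l = upper P f A l) ->
  (forall B, #|B| = 3%N -> i \in B -> incident P (vertex P B) s ->
     exists2 g, g = f \/ g = - f & forall l, l != i -> s l = upper P g B l) ->
  exists j k, [/\ A = [set i; j; k]%SET, [&& j != i, k != i & j != k] & top f s i j].
Proof.
move=> hf cA iA hs sA hall.
have [k' kA ki] := other_member cA iA.
have ik : i != k' by rewrite eq_sym.
have [j' [ji jk AE]] := triple_set cA iA kA ik.
have hfN := genericN hf.
have step j k : A = [set i; j; k]%SET -> j != i -> k != i -> j != k ->
    top f s i j \/ exists2 B : {set 'I_n}, [/\ #|B| = 3%N, i \in B & incident P (vertex P B) s] &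
      [/\ j \in B, k \notin B & forall l, l != i -> s l = upper P (- f) B l].
  move=> {}AE {}ji {}ki {}jk.
  have {}kA : k \in A by rewrite AE !inE eqxx !orbT.
  have jA : j \in A by rewrite AE !inE eqxx !orbT.
  have AkE l : l |: A :\ k = [set i; j; l]%SET.
    apply/setP => m; rewrite AE !inE.
    have [->|mk] := eqVneq m k; last by rewrite /= !orbF; case: (m == l); rewrite ?orbT ?orbF.
    by rewrite (negPf ki) (eq_sym k j) (negPf jk) /= orbF.
  have [[l lA hl]|hl] := next_vertex hf cA kA hs (sA k ki); last first.
    left=> l li lj; have [->|lk] := eqVneq l k; first by rewrite -AE sA.
    by rewrite -AkE hl // AE !inE (negPf li) (negPf lj) (negPf lk).
  right; exists (l |: A :\ k).
    by split; rewrite ?card_swap // !inE iA (eq_sym i k) ki orbT.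
  have cB := card_swap cA kA lA.
  have iB : i \in l |: A :\ k by rewrite !inE iA (eq_sym i k) ki orbT.
  have kB : k \notin l |: A :\ k.
    by rewrite !inE eqxx orbF; apply: contraNneq lA => <-.
  split=> //; first by rewrite !inE jA jk orbT.
  have [g [->|->] hg] // := hall _ cB iB hl.
  by move: kB; rewrite -(upper_face_unique hf cA cB iA iB hs hl sA hg) kA.
have [|[B1 [c1 i1 h1] [jB1 kB1 u1]]] := step j' k' AE ji ki jk.
  by exists j', k'; rewrite ji ki jk.
have kj : k' != j' by rewrite eq_sym.
have AE' : A = [set i; k'; j']%SET by rewrite AE finset.setUAC.
have [|[B2 [c2 i2 h2] [jB2 kB2 u2]]] := step k' j' AE' ki ji kj.
  by exists k', j'; rewrite ji ki kj.
by move: kB1; rewrite (upper_face_unique hfN c1 c2 i1 i2 h1 h2 u1 u2) jB2.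
Qed.

End Rays.

(** * Charging vertices, faces and chambers to boundary facets *)

Section Counting.
Local Open Scope nat_scope.
Local Open Scope set_scope.

(** A relation instead of a map lets the choices made in a charging scheme,
such as that of a vertex of a face, stay inside the proofs. *)
Lemma card_le_rel (T U : finType) (X : {set T}) (Y : {set U}) (r : T -> U -> Prop) :
  (forall x, x \in X -> exists2 y, y \in Y & r x y) ->
  (forall x x' y, x \in X -> x' \in X -> r x y -> r x' y -> x = x') ->
  #|X| <= #|Y|.
Proof.
move=> hr hinj.
have [->|[x0 x0X]] := set_0Vmem X; first by rewrite cards0.
have [y0 _ _] := hr _ x0X.
pose g x := xget y0 [set y | y \in Y /\ r x y]%classic.
have gP x : x \in X -> g x \in Y /\ r x (g x).
  move=> /hr[y yY rxy]; rewrite /g; case: xgetP => [y' _ //|/(_ y) []].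
  by split.
have ginj : {in X &, injective g}.
  move=> x x' xX x'X e; have [_ h1] := gP x xX; have [_ h2] := gP x' x'X.
  by apply: (hinj x x' (g x)) => //; rewrite e.
rewrite -(card_in_imset ginj); apply: subset_leq_card.
by apply/fintype.subsetP => _ /imsetP[x xX ->]; case: (gP x xX).
Qed.

Lemma card_le_fibers (T U : finType) (c : nat) (X : {set T}) (Y : {set U})
    (r : T -> U -> bool) :
  (forall x, x \in X -> exists2 y, y \in Y & r x y) ->
  (forall y, y \in Y -> #|[set x in X | r x y]| <= c) ->
  #|X| <= c * #|Y|.
Proof.
move=> hr hc; rewrite -sum1_card.
apply: (@leq_trans (\sum_(x in X) \sum_(y in Y) r x y)).
  apply: leq_sum => x /hr[y yY rxy].
  by rewrite (bigD1 y) //= rxy.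
rewrite exchange_big /= mulnC -sum_nat_const.
apply: leq_sum => y /hc; apply: leq_trans.
rewrite -sum1_card big_mkcond [in X in _ <= X]big_mkcond.
by apply: leq_sum => x _; rewrite inE; case: (x \in X); case: (r x y).
Qed.

End Counting.

Section Boundary.
Local Open Scope set_scope.
Variables (R : realType) (n : nat) (P : simple_planes R n).
Variables (S : {set signs n}) (f : 'cV[R]_3).
Hypothesis hf : generic P f.
Hypothesis hS : forall s, s \in S -> realized P s.
Implicit Types (A B : {set 'I_n}) (i j k l m : 'I_n) (s t : signs n) (g : 'cV[R]_3).

Notation at_vertex A s := (incident P (vertex P A) s).

Definition boundary_facet s i : bool :=
  [&& realized P s, realized P (flip i s) & (s \in S) != (flip i s \in S)].

(** Each boundary facet is listed twice, once from each of its two chambers,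
which makes the list the same for a family and for its complement. *)
Definition boundary_facets : {set signs n * 'I_n} :=
  [set e : signs n * 'I_n | boundary_facet e.1 e.2].

(** The edge at the vertex of [A] off plane [m], on its side [b], is inside
the thickening. *)
Definition half_full A m (b : bool) : bool :=
  [forall s, at_vertex A s && (s m == b) ==> (s \in S)].

(** The vertex of [A] is inside the thickening. *)
Definition full A : bool := [forall s, at_vertex A s ==> (s \in S)].

Definition good g A : bool := [exists k in A, boundary_facet (upper P g A) k].

Definition good_vertices : {set {set 'I_n}} :=
  [set A : {set 'I_n} | (#|A| == 3%N) && (good f A || good (- f) A)].

Definition full_triples : {set {set 'I_n}} := [set A : {set 'I_n} | (#|A| == 3%N) && full A].

Definition line_ends : {set {set 'I_n} * 'I_n * bool} :=
  [set e : {set 'I_n} * 'I_n * bool |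
    [&& #|e.1.1| == 3%N, e.1.2 \in e.1.1, half_full e.1.1 e.1.2 e.2 & ~~ full e.1.1]].

(** The faces inside the thickening, listed from their two sides, none of
whose edges is inside it. An edge of the face at a vertex [A] is off a plane
[k] of [A] other than the plane of the face. *)
Definition isolated_faces : {set signs n * 'I_n} :=
  [set e : signs n * 'I_n | [&& e.1 \in S, flip e.2 e.1 \in S &
    [forall A : {set 'I_n}, [&& #|A| == 3%N, e.2 \in A & at_vertex A e.1] ==>
       [forall k in A, (k != e.2) ==> ~~ half_full A k (e.1 k)]]]].

(** The face [e] and some boundary facet, in another plane, have the same
upward ray as an edge. *)
Definition charged g : {set signs n * 'I_n} :=
  [set e : signs n * 'I_n | `[< exists t j, [/\ boundary_facet t j, e.2 != j, top P g t e.2 j &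
                               forall l, l != e.2 -> e.1 l = t l] >]].

Lemma fullP A : reflect (forall s, at_vertex A s -> s \in S) (full A).
Proof. by apply: (iffP forallP) => h s; [move/implyP: (h s)|apply/implyP/h]. Qed.

Lemma half_fullP A m b : reflect (forall s, at_vertex A s -> s m = b -> s \in S) (half_full A m b).
Proof.
apply: (iffP forallP) => h s; last by apply/implyP => /andP[h1 /eqP]; exact: h.
by move=> h1 h2; move/implyP: (h s); apply; rewrite h1 h2 eqxx.
Qed.

Lemma good_le_boundary g : generic P g ->
  (#|[set A : {set 'I_n} | (#|A| == 3%N) && good g A]| <= #|boundary_facets|)%N.
Proof.
move=> hg; apply: (@card_le_rel _ _ _ _ (fun A e => e.1 = upper P g A)).
  move=> A; rewrite inE => /andP[_ /existsP[k /andP[kA hk]]].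
  by exists (upper P g A, k) => //; rewrite inE.
move=> A B [s k]; rewrite !inE /= => /andP[/eqP cA _] /andP[/eqP cB _] -> .
exact: upper_inj.
Qed.

Lemma card_good_vertices : (#|good_vertices| <= 2 * #|boundary_facets|)%N.
Proof.
have -> : good_vertices = [set A : {set 'I_n} | (#|A| == 3%N) && good f A] :|:
    [set A : {set 'I_n} | (#|A| == 3%N) && good (- f) A].
  by apply/setP => A; rewrite !inE andb_orr.
rewrite mul2n -addnn; apply: leq_trans (leq_card_setU _ _) _.
by apply: leq_add; apply: good_le_boundary => //; exact: genericN.
Qed.

Lemma at_vertex_card A : #|A| = 3%N -> (#|[set s | at_vertex A s]| <= 8)%N.
Proof.
move=> cA; have -> : 8%N = #|powerset A| by rewrite card_powerset cA.
apply: (@card_le_rel _ _ _ _ (fun s X => X = [set i in A | s i]%SET)).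
  move=> s _; exists [set i in A | s i]%SET => //.
  by rewrite powersetE; apply/fintype.subsetP => i; rewrite inE => /andP[].
move=> s t X; rewrite !inE => hs ht -> /setP h; apply/ffunP => i.
have [iA|iA] := boolP (i \in A); last exact: incident_off hs ht iA.
by have := h i; rewrite !inE iA.
Qed.

(** At the other vertices membership in [S] is constant on each of the two
stars formed by an extreme chamber and its three neighbours. *)
Lemma not_good A : #|A| = 3%N -> A \notin good_vertices ->
  forall g, g = f \/ g = - f -> forall k, k \in A ->
  (flip k (upper P g A) \in S) = (upper P g A \in S).
Proof.
move=> cA; rewrite inE cA /= negb_or => /andP[h1 h2] g hg k kA.
have hu := upper_incident P g cA.
have ng : ~~ good g A by case: hg => ->.
have := existsPn ng k; rewrite kA /= /boundary_facet (incident_vertex_realized cA hu).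
rewrite (incident_vertex_realized cA (incident_flip cA kA hu)) /=.
by rewrite negbK => /eqP.
Qed.

Lemma other_sign g : g = f \/ g = - f -> - g = f \/ - g = - f.
Proof. by case=> ->; [right|left; rewrite opprK]. Qed.

Lemma generic_sign g : g = f \/ g = - f -> generic P g.
Proof. by case=> ->; last exact: genericN. Qed.

Lemma flip2 g A i j k : generic P g -> #|A| = 3%N -> A = [set i; j; k]%SET ->
  i != j -> i != k -> j != k ->
  flip j (flip i (upper P g A)) = flip k (upper P (- g) A).
Proof.
move=> hg cA AE ij ik jk; apply/ffunP => l; rewrite !flipE upperN // AE !inE -AE.
have [->|li] := eqVneq l i; first by rewrite (negPf ij) (negPf ik).
have [->|lj] := eqVneq l j; first by rewrite (negPf jk).
by have [->|lk] := eqVneq l k; rewrite //= negbK.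
Qed.

(** A vertex that is neither good nor full but touches [S] is a monkey saddle: one
of its two stars is in [S] and the other one is outside. *)
Lemma saddle_vertex A s : #|A| = 3%N -> A \notin good_vertices -> at_vertex A s -> s \in S ->
  ~~ full A -> exists2 g, g = f \/ g = - f &
  [/\ upper P g A \in S, upper P (- g) A \notin S &
      s = upper P g A \/ exists2 k, k \in A & s = flip k (upper P g A)].
Proof.
move=> cA nA hs sS nf; have [g hg hsg] := star_cover hf cA hs.
have hN := other_sign hg.
have ug : upper P g A \in S.
  by case: hsg => [<- //|[k kA e]]; rewrite -(not_good cA nA hg kA) -e.
exists g => //; split=> //; apply: contra nf => uN; apply/fullP => t ht.
have [g' hg' htg] := star_cover hf cA ht.
have ug' : upper P g' A \in S.
  by case: hg hg' ug uN => -> [] ->; rewrite ?opprK.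
by case: htg => [->//|[k kA ->]]; rewrite (not_good cA nA hg').
Qed.

(** Around an end, four chambers on one side of a plane are in [S]. They meet
both stars of the vertex, which excludes a monkey saddle. *)
Lemma line_end_good e : e \in line_ends -> e.1.1 \in good_vertices.
Proof.
case: e => [[A m] b]; rewrite inE /= => /and4P[/eqP cA mA /half_fullP hh nf].
apply/negPn/negP => nA.
(* the side [b] of plane [m] meets both stars *)
have [g hg gm] : exists2 g, g = f \/ g = - f & upper P g A m = b.
  have [e|e] := eqVneq (upper P f A m) b; first by exists f; [left|].
  exists (- f); first by right.
  by rewrite upperN // mA /=; move: e; case: (upper P f A m); case: (b).
have gS : upper P g A \in S by apply: hh => //; exact: upper_incident.
have NS : upper P (- g) A \in S.
  rewrite -(not_good cA nA (other_sign hg) mA); apply: hh.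
    by apply: incident_flip => //; exact: upper_incident.
  by rewrite flip_id upperN ?mA ?gm ?negbK //; exact: generic_sign.
have [g' hg' [h1 h2 _]] := saddle_vertex cA nA (upper_incident P g cA) gS nf.
by move: h2; case: hg hg' gS NS => -> [] ->; rewrite ?opprK => h3 h4; rewrite ?h3 ?h4.
Qed.

Lemma card_line_ends : (#|line_ends| <= 12 * #|boundary_facets|)%N.
Proof.
apply: (@leq_trans (6 * #|good_vertices|)); last first.
  by rewrite (_ : 12 = 6 * 2)%N // -mulnA leq_mul2l card_good_vertices orbT.
apply: (@card_le_fibers _ _ _ _ _ (fun e A => e.1.1 == A)).
  by move=> e /line_end_good he; exists e.1.1.
move=> A; rewrite inE => /andP[/eqP cA _].
apply: (@leq_trans #|finset.setX (finset.setX [set A] A) [set: bool]|); last first.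
  by rewrite !cardsX cards1 cA cardsT card_bool.
apply: subset_leq_card; apply/fintype.subsetP => -[[B m] b].
by rewrite !inE /= => /andP[/and4P[_ mB _ _] /eqP <-]; rewrite eqxx mB.
Qed.

(** A boundary facet has at most two rays by [top_side], and a face is
determined by the ray, its plane and one sign. *)
Lemma card_charged g : generic P g -> (#|charged g| <= 4 * #|boundary_facets|)%N.
Proof.
move=> hg; have -> : (4 * #|boundary_facets| = #|finset.setX boundary_facets [set: bool * bool]|)%N.
  by rewrite cardsX cardsT card_prod card_bool mulnC.
pose r (e : signs n * 'I_n) (y : signs n * 'I_n * (bool * bool)) : Prop :=
  [/\ e.2 != y.1.2, top P g y.1.1 e.2 y.1.2, forall l, l != e.2 -> e.1 l = y.1.1 l,
      side P g y.1.2 y.1.1 e.2 = y.2.1 & e.1 e.2 = y.2.2].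
apply: (@card_le_rel _ _ _ _ r).
  move=> [s i]; rewrite inE => /asboolP[t [j [/= h1 h2 h3 h4]]].
  by exists ((t, j), (side P g j t i, s i)); rewrite ?inE /= ?h1.
move=> [s i] [s' i'] [[t j] [b1 b2]] _ _ [/= a1 a2 a3 a4 a5] [/= c1 c2 c3 c4 c5].
have e : i = i' by apply: (top_side hg a1 c1 a2 c2); rewrite a4 c4.
rewrite -e in c3 c5 *; congr (_, _); apply/ffunP => l.
by have [->|li] := eqVneq l i; [rewrite a5 c5|rewrite a3 // c3].
Qed.

Lemma card_charged_both : (#|charged f :|: charged (- f)| <= 8 * #|boundary_facets|)%N.
Proof.
rewrite (_ : 8 = 4 + 4)%N // mulnDl; apply: leq_trans (leq_card_setU _ _) _.
by apply: leq_add; apply: card_charged => //; exact: genericN.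
Qed.

(** At a monkey saddle, crossing plane [i] from the upper chamber stays in
[S], and crossing a second plane leaves it. When the plane [j] is chosen by
[ray_edge], the facet crossed second has the ray as an edge. *)
Lemma ray_charged g A s i : g = f \/ g = - f -> #|A| = 3%N -> i \in A -> A \notin good_vertices ->
  at_vertex A s -> (forall l, l != i -> s l = upper P g A l) ->
  upper P g A \in S -> upper P (- g) A \notin S ->
  (forall B, #|B| = 3%N -> i \in B -> at_vertex B s ->
     exists2 g, g = f \/ g = - f & forall l, l != i -> s l = upper P g B l) ->
  (s, i) \in charged g.
Proof.
move=> hg cA iA nA hs sA uS uN hall; have hgg := generic_sign hg.
have [|j [k [AE /and3P[ji ki jk] htop]]] := ray_edge hgg cA iA hs sA.
  move=> B cB iB hB; have [g' hg' h'] := hall B cB iB hB; exists g' => //.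
  by case: hg hg' => -> [] ->; rewrite ?opprK; auto.
have jA : j \in A by rewrite AE !inE eqxx orbT.
have kA : k \in A by rewrite AE !inE eqxx orbT.
rewrite inE; apply/asboolP; exists (flip i (upper P g A)), j; split => /=.
- have hu := upper_incident P g cA; have hi := incident_flip cA iA hu.
  rewrite /boundary_facet (incident_vertex_realized cA hi).
  rewrite (incident_vertex_realized cA (incident_flip cA jA hi)) /=.
  rewrite (not_good cA nA hg iA) uS.
  rewrite (flip2 hgg cA AE) // 1?eq_sym // (not_good cA nA (other_sign hg) kA).
  by rewrite (negPf uN).
- by rewrite eq_sym.
- by move=> l li lj; rewrite flip_neq // -sA //; exact: htop.
- by move=> l li; rewrite flip_neq // sA.
Qed.

(** All vertices of the face are monkey saddles. As both chambers along the
face are in [S], they are an extreme chamber and its neighbour across the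
plane of the face, so each vertex is the lowest or the highest one of the
face. *)
Lemma isolated_charged s i : (s, i) \in isolated_faces ->
  (forall A, #|A| = 3%N -> i \in A -> at_vertex A s -> A \notin good_vertices) ->
  (exists A, [/\ #|A| = 3%N, i \in A & at_vertex A s]) ->
  (s, i) \in charged f :|: charged (- f).
Proof.
rewrite inE => /and3P[/= sS fS /forallP hiso] hng [A [cA iA hs]].
have key B : #|B| = 3%N -> i \in B -> at_vertex B s -> exists2 g, g = f \/ g = - f &
    [/\ forall l, l != i -> s l = upper P g B l, upper P g B \in S
      & upper P (- g) B \notin S].
  move=> cB iB hB; have nB := hng B cB iB hB.
  have nf : ~~ full B.
    have [k kB ki] := other_member cB iB.
    move/implyP: (hiso B); rewrite cB iB hB => /(_ isT) /forallP/(_ k).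
    rewrite kB ki /=; apply: contra => /fullP h; apply/half_fullP => t ht _; exact: h.
  have [g hg [uS uN hsg]] := saddle_vertex cB nB hB sS nf; exists g => //; split=> //.
  case: hsg => [-> //|[k kB e]].
  have [ki|ki] := eqVneq k i; first by move=> l li; rewrite e ki flip_neq.
  have [|m [mi mk BE]] := triple_set cB iB kB; first by rewrite eq_sym.
  have hgg := generic_sign hg.
  move: fS; rewrite e (@flip2 g B k i m) //; last first.
  - by rewrite eq_sym.
  - by rewrite eq_sym.
  - by rewrite BE; apply/setP => x; rewrite !inE; do !case: eqP.
  have mB : m \in B by rewrite BE !inE eqxx orbT.
  by rewrite (not_good cB nB (other_sign hg) mB) (negPf uN).
have [g hg [sA uS uN]] := key A cA iA hs.
have : (s, i) \in charged g.
  apply: (ray_charged hg cA iA (hng A cA iA hs) hs sA uS uN) => B cB iB hB.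
  by have [g' hg' [h _ _]] := key B cB iB hB; exists g'.
by move=> h; rewrite finset.in_setU; case: hg => e; rewrite -e h ?orbT.
Qed.

(** Two chambers whose signs differ for one plane only have a common facet,
met by any segment between them. *)
Lemma crossing s i : realized P s -> realized P (flip i s) ->
  exists z, height P i z = 0 /\ forall j, j != i -> 0 < sg R (s j) * height P j z.
Proof.
move=> /asboolP[x /in_cellP hx] /asboolP[y /in_cellP hy].
have := hx i; have := hy i; rewrite flip_id sgN.
set a := height P i x; set b := height P i y => hb ha.
have nz : a - b != 0.
  by apply/eqP => h; move: ha hb; case: (s i); rewrite /sg; lra.
exists (x + (a / (a - b)) *: (y - x)); rewrite height_seg -/a -/b; split.
  by field.
move=> j ji; rewrite height_seg; have := hx j; have := hy j; rewrite flip_neq //.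
have t01 : 0 < a / (a - b) < 1.
  move: ha hb; case: (s i); rewrite /sg => ha hb.
    by rewrite divr_gt0 ?ltr_pdivrMr; lra.
  have -> : a / (a - b) = (- a) / (b - a) by field; rewrite nz -opprB oppr_eq0 nz.
  by rewrite divr_gt0 ?ltr_pdivrMr; lra.
move: (a / (a - b)) t01 => t /andP[t0 t1] h1 h2.
by rewrite mulrDr mulrCA [X in _ + X]mulrCA; apply: addr_gt0; apply: mulr_gt0 => //; lra.
Qed.

Lemma face_vertex s i : realized P s -> realized P (flip i s) ->
  exists A, [/\ #|A| = 3%N, i \in A & at_vertex A s].
Proof.
move=> h1 h2; have [z [zi hz]] := crossing h1 h2.
have [A [cA sA hA]] := push_vertex P z; exists A; split=> //.
  by apply: (fintype.subsetP sA); rewrite inE zi.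
apply: hA; apply/incidentP => j; have [->|/hz/ltW//] := eqVneq j i.
by rewrite zi mulr0.
Qed.

Lemma card_isolated_faces : (#|isolated_faces| <= 56 * #|boundary_facets|)%N.
Proof.
pose X1 := [set e in isolated_faces | [exists A in good_vertices, (e.2 \in A) && at_vertex A e.1]].
have h1 : (#|X1| <= 24 * #|good_vertices|)%N.
  apply: (@card_le_fibers _ _ _ _ _ (fun e A => (e.2 \in A) && at_vertex A e.1)).
    by move=> e; rewrite inE => /andP[_ /existsP[A /andP[h1 h2]]]; exists A.
  move=> A; rewrite inE => /andP[/eqP cA _].
  apply: (@leq_trans #|finset.setX [set s | at_vertex A s] A|).
    apply: subset_leq_card; apply/fintype.subsetP => e.
    by rewrite !inE => /andP[_ /andP[-> ->]].
  by rewrite cardsX cA (leq_mul2r 3 _ 8) at_vertex_card ?orbT.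
have sub : isolated_faces \subset X1 :|: (charged f :|: charged (- f)).
  apply/fintype.subsetP => -[s i] he; rewrite inE.
  have [//|/= nX] := boolP ((s, i) \in X1).
  apply: isolated_charged => //.
    move=> A cA iA hs; apply: contra nX => hA; rewrite inE he.
    by apply/existsP; exists A; rewrite hA /= iA.
  by move: he; rewrite inE => /and3P[/= h2 h3 _]; apply: face_vertex; exact: hS.
apply: leq_trans (subset_leq_card sub) _.
apply: leq_trans (leq_card_setU _ _) _.
rewrite (_ : (56 * _ = 24 * (2 * #|boundary_facets|) + 8 * #|boundary_facets|)%N); last by lia.
apply: leq_add card_charged_both.
by apply: leq_trans h1 _; rewrite leq_mul2l card_good_vertices orbT.
Qed.

Lemma card_boundary_chambers :
  (#|[set s in S | [exists i, boundary_facet s i]]| <= #|boundary_facets|)%N.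
Proof.
apply: (@card_le_rel _ _ _ _ (fun s e => e.1 = s)).
  by move=> s; rewrite inE => /andP[_ /existsP[i hi]]; exists (s, i); rewrite ?inE.
by move=> s s' e _ _ <- <-.
Qed.

(** The same charge for a chamber without boundary facet all of whose
vertices are monkey saddles, each of them being its lowest or its highest
vertex. *)
Lemma chamber_charged s : s \in S ->
  (forall A, #|A| = 3%N -> at_vertex A s -> ~~ full A) ->
  (forall A, #|A| = 3%N -> at_vertex A s -> A \notin good_vertices) ->
  (forall i, ~~ boundary_facet s i) ->
  exists i, (s, i) \in charged f :|: charged (- f).
Proof.
move=> sS hnf hng hnb.
have /asboolP[x /in_cell_incident hx] := hS sS.
have [A [cA _ /(_ s hx) hs]] := push_vertex P x.
have key B : #|B| = 3%N -> at_vertex B s -> exists2 g, g = f \/ g = - f &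
    [/\ s = upper P g B, upper P g B \in S & upper P (- g) B \notin S].
  move=> cB hB; have nB := hng B cB hB.
  have [g hg [uS uN hsg]] := saddle_vertex cB nB hB sS (hnf B cB hB); exists g => //; split=> //.
  case: hsg => [//|[k kB e]]; exfalso.
  have [i iB ik] := other_member cB kB.
  have [m [mi mk BE]] := triple_set cB iB kB ik.
  have hgg := generic_sign hg.
  have mB : m \in B by rewrite BE !inE eqxx orbT.
  have : flip i s \notin S.
    rewrite e (@flip2 g B k i m) //; last first.
    - by rewrite eq_sym.
    - by rewrite eq_sym.
    - by rewrite eq_sym.
    - by rewrite BE; apply/setP => y; rewrite !inE; do !case: eqP.
    by rewrite (not_good cB nB (other_sign hg) mB).
  move: (hnb i); rewrite /boundary_facet (incident_vertex_realized cB hB).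
  rewrite (incident_vertex_realized cB (incident_flip cB iB hB)) sS /=.
  by case: (flip i s \in S).
have [i iA] : exists i, i \in A by apply/card_gt0P; rewrite cA.
have [g hg [sA uS uN]] := key A cA hs; exists i.
have : (s, i) \in charged g.
  apply: (ray_charged hg cA iA (hng A cA hs) hs _ uS uN) => [l _|B cB iB hB].
    by rewrite {1}sA.
  by have [g' hg' [h _ _]] := key B cB hB; exists g' => // l _; rewrite {1}h.
by move=> h; rewrite finset.in_setU; case: hg => e; rewrite -e h ?orbT.
Qed.

Lemma card_chambers_le : (#|S| <= 8 * #|full_triples| + 25 * #|boundary_facets|)%N.
Proof.
pose X (Y : {set {set 'I_n}}) := [set s in S | [exists A in Y, at_vertex A s]].
have hX (Y : {set {set 'I_n}}) : (forall A, A \in Y -> #|A| = 3%N) -> (#|X Y| <= 8 * #|Y|)%N.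
  move=> hY; apply: (@card_le_fibers _ _ _ _ _ (fun s A => at_vertex A s)).
    by move=> s; rewrite inE => /andP[_ /existsP[A /andP[h1 h2]]]; exists A.
  move=> A AY; apply: leq_trans (at_vertex_card (hY A AY)).
  by apply: subset_leq_card; apply/fintype.subsetP => s; rewrite !inE => /andP[].
have h1 : (#|X full_triples| <= 8 * #|full_triples|)%N.
  by apply: hX => A; rewrite inE => /andP[/eqP].
have h2 : (#|X good_vertices| <= 8 * #|good_vertices|)%N.
  by apply: hX => A; rewrite inE => /andP[/eqP].
pose Z := [set s in S | [exists i, (s, i) \in charged f :|: charged (- f)]].
have h3 : (#|Z| <= #|charged f :|: charged (- f)|)%N.
  apply: (@card_le_rel _ _ _ _ (fun s e => e.1 = s)).
    by move=> s; rewrite inE => /andP[_ /existsP[i hi]]; exists (s, i).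
  by move=> s s' e _ _ <- <-.
pose W := [set s in S | [exists i, boundary_facet s i]].
have sub : S \subset (X full_triples :|: X good_vertices) :|: (W :|: Z).
  apply/fintype.subsetP => s sS; rewrite !inE sS /=.
  have [//|n1] := boolP [exists A in full_triples, at_vertex A s].
  have [//|n2] := boolP [exists A in good_vertices, at_vertex A s].
  have [//|n3] := boolP [exists i, boundary_facet s i] => /=.
  apply/existsP; have [| | |i] := chamber_charged sS; last by exists i.
  - move=> A cA hA; have := existsPn n1 A; rewrite inE cA hA eqxx /=.
    by rewrite andbT.
  - by move=> A cA hA; have := existsPn n2 A; rewrite hA andbT.
  - by move=> i; exact: (existsPn n3 i).
apply: leq_trans (subset_leq_card sub) _.
apply: leq_trans (leq_card_setU _ _) _.
rewrite (_ : (8 * _ + _ = 8 * #|full_triples| + 8 * (2 * #|boundary_facets|) +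
                          (#|boundary_facets| + 8 * #|boundary_facets|))%N); last by lia.
apply: leq_add; apply: leq_trans (leq_card_setU _ _) _; apply: leq_add => //.
- by apply: leq_trans h2 _; rewrite leq_mul2l card_good_vertices.
- exact: card_boundary_chambers.
- exact: leq_trans h3 card_charged_both.
Qed.

End Boundary.

(** * Ends of the thickening along a line *)

Section Lines.
Local Open Scope set_scope.
Variables (R : realType) (n : nat) (P : simple_planes R n).
Variables (S : {set signs n}).
Implicit Types (A B : {set 'I_n}) (i j k l m : 'I_n) (s t : signs n) (x y z v w : 'rV[R]_3).

(** Membership in the thickening, for the family of chambers encoded by [S]. *)
Definition inner x : bool := [forall s, incident P x s ==> (s \in S)].

Lemma innerP x : reflect (forall s, incident P x s -> s \in S) (inner x).
Proof. by apply: (iffP forallP) => h s; [move/implyP: (h s)|apply/implyP/h]. Qed.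

Lemma inner_vertex A : inner (vertex P A) = full P S A.
Proof. by []. Qed.

(** Inside a closed cell, the planes through a point of an open segment pass
through both ends of the segment. *)
Lemma inner_seg x y s (u : R) : incident P x s -> incident P y s ->
  inner x -> inner y -> 0 <= u <= 1 -> inner (x + u *: (y - x)).
Proof.
move=> /incidentP xs /incidentP ys /innerP ix iy /andP[u0].
rewrite le_eqVlt => /orP[/eqP->|u1]; first by rewrite scale1r addrC subrK.
apply/innerP => t /incidentP ht; apply: ix; apply/incidentP => i.
have := ht i; have := xs i; have := ys i; rewrite height_seg.
move: (height P i x) (height P i y) => a b.
case: (s i) => h1 h2; case: (t i); rewrite /sg in h1 h2 *; nra.
Qed.

(** Going back from time [u'] to time [u], no plane is left before it is
reached, so the chambers around the later point are also around the earlier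
one. *)
Lemma incident_back x v (u u' : R) s : u <= u' ->
  (forall l, slope P l v != 0 -> ~~ (u < - height P l x / slope P l v <= u')) ->
  incident P (x + u' *: v) s -> incident P (x + u *: v) s.
Proof.
move=> uu' hl /incidentP hs; apply/incidentP => l.
have := hs l; rewrite !heightZ => h1; rewrite leNgt; apply/negP => h2.
have d0 : slope P l v != 0.
  by apply/eqP => d0; move: h1 h2; rewrite d0 !mulr0 => h1 h2; lra.
have := hl l d0; set r := - _ / _ => /negP; apply.
have hr : height P l x = - r * slope P l v by rewrite /r -mulNr opprK divfK.
move: h1 h2 d0; rewrite hr; move: (slope P l v) => D.
by case: (s l); rewrite /sg => h1 h2 d0; apply/andP; split; nra.
Qed.

(** Take the last plane crossed before the point outside: every chamber
around that point is also around the crossing. *)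
Lemma exit_time x v (u : R) : inner x -> 0 < u -> ~~ inner (x + u *: v) ->
  exists l, [/\ slope P l v != 0, 0 < - height P l x / slope P l v <= u &
    ~~ inner (x + (- height P l x / slope P l v) *: v)].
Proof.
move=> ix u0 niu; pose r l := - height P l x / slope P l v.
pose Q l := (slope P l v != 0) && (0 < r l <= u).
case: (pickP Q) => [l0 Ql0|hno]; last first.
  case/negP: niu; apply/innerP => s hs; move/innerP: ix; apply.
  rewrite -[x]addr0 -(scale0r v); apply: incident_back hs; first exact: ltW.
  by move=> l hl; have := hno l; rewrite /Q hl /= => ->.
case: (@arg_maxP _ R _ l0 Q r Ql0) => l /andP[d0 hl] lmax.
exists l; split=> //; apply: contra niu => /innerP iw; apply/innerP => s hs.
apply: iw; apply: incident_back hs; first by case/andP: hl.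
move=> m dm; apply/negP => /andP[h1 h2].
have := lmax m; rewrite /Q dm /= h2 andbT -/(r m).
case/andP: hl => hl _; rewrite (lt_trans hl h1) => /(_ isT).
by rewrite leNgt h1.
Qed.

(** Walking along a line from a point of the thickening to a point outside, the
first exit is at a vertex that ends a segment of the thickening. *)
Lemma exists_end x z i j : i != j ->
  i \in zeros P x -> j \in zeros P x -> i \in zeros P z -> j \in zeros P z ->
  inner x -> ~~ inner z ->
  exists l b, let A := [set i; j; l] in let w := vertex P A in
    [/\ (A, l, b) \in line_ends P S, [&& l != i & l != j], 0 < sg R b * height P l x
      & forall u : R, 0 <= u < 1 -> inner (x + u *: (w - x))].
Proof.
move=> ij; rewrite !inE => /eqP xi /eqP xj /eqP zi /eqP zj ix nz.
pose v := z - x.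
pose r l := - height P l x / slope P l v.
pose Q l := [&& slope P l v != 0, 0 < r l <= 1 & ~~ inner (x + r l *: v)].
have [l0 Ql0] : exists l, Q l.
  have [||l [h1 h2 h3]] := @exit_time x v 1 ix; first exact: ltr01.
    by rewrite scale1r addrC subrK.
  by exists l; rewrite /Q h1 h2 h3.
case: (@arg_minP _ R _ l0 Q r Ql0) => l /and3P[d0 /andP[r0 r1] nw] lmin.
have li : l != i.
  by apply: contraNneq d0 => ->; rewrite slopeB xi zi subrr.
have lj : l != j.
  by apply: contraNneq d0 => ->; rewrite slopeB xj zj subrr.
pose A := [set i; j; l].
have cA : #|A| = 3%N by rewrite /A finset.setUC cardsU1 !inE cards2 negb_or li lj ij.
have AE : A :\ l = [set i; j].
  by apply/setP => m; rewrite !inE; have [->|] := eqVneq m l; rewrite ?(negPf li) ?(negPf lj) ?orbF.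
have lA : l \in A by rewrite !inE eqxx orbT.
have wE : x + r l *: v = vertex P A.
  apply: vertex_unique => //; apply/fintype.subsetP => m; rewrite !inE heightZ.
  rewrite -orbA => /or3P[] /eqP->.
  - by rewrite slopeB xi zi subrr mulr0 addr0.
  - by rewrite slopeB xj zj subrr mulr0 addr0.
  - by rewrite /r divfK // addrN.
have hx0 : height P l x != 0.
  by apply: contraTneq r0 => e; rewrite /r e oppr0 mul0r ltxx.
pose b := 0 < height P l x.
have hb : 0 < sg R b * height P l x by exact: sg_pos.
have hin (u : R) : 0 <= u < 1 -> inner (x + u *: (vertex P A - x)).
  move=> /andP[u0 u1]; rewrite -wE addrAC subrr add0r scalerA.
  apply/negPn/negP => ni.
  have ur : 0 < u * r l.
    rewrite mulr_gt0 // lt_neqAle u0 andbT; apply: contraNneq ni => <-.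
    by rewrite mul0r scale0r addr0.
  have [m [h1 h2 h3]] := exit_time ix ur ni.
  have ul : u * r l < r l by rewrite -[ltRHS]mul1r ltr_pM2r.
  case/andP: (h2) => h2a h2b.
  have := lmin m; rewrite /Q h1 h2a h3 (le_trans h2b) ?(le_trans (ltW ul)) // => /(_ isT).
  by rewrite leNgt (le_lt_trans h2b ul).
have xE : x = vertex P A + height P l x *: dual P A l.
  apply: on_line => //; rewrite AE; apply/fintype.subsetP => m; rewrite !inE.
  by case/orP => /eqP->; rewrite ?xi ?xj.
exists l, b; split=> //; last by rewrite li lj.
rewrite inE /= cA eqxx lA -inner_vertex -wE nw andbT /=.
apply/half_fullP => s hs sb.
have sY : [set i; j] \subset A by rewrite -AE finset.subsetDl.
have [e0 e00 he] := near_vertex cA sY hs.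
pose e := Num.min e0 (sg R b * height P l x).
have epos : 0 < e by rewrite lt_min e00 hb.
have [|hz1 hz2] := he e epos; first by rewrite ge_min lexx.
set z' := (_ + _) in hz1 hz2.
have z'E : z' = x + (1 - e / (sg R b * height P l x)) *: (vertex P A - x).
  rewrite /z' (bigD1 l) /=; last by rewrite lA !inE negb_or li lj.
  rewrite big1 ?addr0; last first.
    move=> m /andP[/andP[mA mY] ml]; move: mA mY; rewrite !inE -orbA.
    by case/or3P => /eqP em; rewrite em ?eqxx ?orbT // in ml *.
  rewrite sb; move: hx0 xE; move: (height P l x) => h hx0 xE.
  rewrite xE opprD addNKr -addrA; congr (_ + _).
  rewrite scalerN scalerA scalerA -scalerBl; congr (_ *: _).
  have h0 : sg R b != 0 := sg_neq0 R b.
  have s2 := sg_sq R b.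
  have -> : e / (sg R b * h) = sg R b * (e / h).
    by rewrite -[in LHS](mulr1 e) -s2; field; rewrite hx0 h0.
  by field.
have : inner z'.
  rewrite z'E; apply: hin.
  have : e / (sg R b * height P l x) <= 1 by rewrite ler_pdivrMr // mul1r ge_min lexx orbT.
  have : 0 < e / (sg R b * height P l x) by rewrite divr_gt0.
  by move=> h1 h2; apply/andP; split; lra.
move/innerP; apply; apply/incidentP => m.
have [mY|mY] := boolP (m \in [set i; j]); first by rewrite hz1 // mulr0.
by rewrite ltW // hz2.
Qed.

End Lines.

(** * Triangles, and lines inside the thickening *)

Section Triangles.
Local Open Scope nat_scope.
Local Open Scope set_scope.

(** Cauchy-Schwarz, in the form where one factor is constant. *)
Lemma sum_square_le (I : finType) (E : {set I}) (c : I -> nat) :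
  (\sum_(e in E) c e) ^ 2 <= #|E| * \sum_(e in E) c e ^ 2.
Proof.
rewrite -(leq_pmul2l (_ : 0 < 2)) // -mulnn big_distrl /= big_distrr /=.
apply: (@leq_trans (\sum_(e in E) \sum_(e' in E) (c e ^ 2 + c e' ^ 2))).
  apply: leq_sum => e _; rewrite big_distrr big_distrr /=.
  by apply: leq_sum => e' _; exact: nat_Cauchy.
under eq_bigr do rewrite big_split /= sum_nat_const.
by rewrite big_split /= sum_nat_const -big_distrr /= addnn mul2n.
Qed.

(** Cauchy-Schwarz over the edges reduces to counting pairs of vertices adjacent
to both ends of a pair, and these are determined by two opposite edges. *)
Lemma card_triangles (I : finType) (L : rel I) :
  #|[set t : I * I * I | [&& L t.1.1 t.1.2, L t.1.1 t.2 & L t.1.2 t.2]]| ^ 2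
    <= #|[set e : I * I | L e.1 e.2]| ^ 3.
Proof.
set T := [set t | _]; set E := [set e | _].
pose c (e : I * I) := #|[set k | L e.1 k && L e.2 k]|.
have TE : #|T| = \sum_(e in E) c e.
  rewrite -sum1_card (partition_big (fun t : I * I * I => t.1) (mem E)) /=; last first.
    by move=> [[i j] k]; rewrite !inE /= => /and3P[].
  apply: eq_bigr => -[i j] /[!inE] /= Lij.
  rewrite sum1dep_card /c /=.
  rewrite -[RHS](card_imset _ (f := fun k => (i, j, k))); last by move=> ? ? [].
  apply: eq_card => -[[i' j'] k] ; rewrite !inE /=.
  apply/andP/imsetP => [[/and3P[_ h1 h2] /eqP[e1 e2]]|[k' h [-> -> ->]]].
    by exists k; rewrite ?inE ?e1 ?e2 //= -?e1 -?e2 h1.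
  by move: h; rewrite inE /= Lij eqxx.
rewrite TE (expnS _ 2); apply: leq_trans (sum_square_le _ _) _.
rewrite leq_mul2l; apply/orP; right.
pose Q := [set q : (I * I) * (I * I) | (q.1 \in E) &&
   [&& L q.1.1 q.2.1, L q.1.2 q.2.1, L q.1.1 q.2.2 & L q.1.2 q.2.2]].
have -> : \sum_(e in E) c e ^ 2 = #|Q|.
  rewrite -[RHS]sum1_card (partition_big (fun q : (I * I) * (I * I) => q.1) (mem E)) /=; last first.
    by move=> q; rewrite !inE => /andP[].
  apply: eq_bigr => e eE.
  rewrite sum1dep_card /c -mulnn -cardsX.
  rewrite -[LHS](card_imset _ (f := fun k : I * I => (e, k))); last by move=> ? ? [].
  apply: eq_card => -[e' [k k']]; rewrite !inE /=.
  apply/imsetP/andP => [[[k1 k2] h [-> -> ->]]|[/andP[_ /and4P[h1 h2 h3 h4]] /eqP ee]].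
    move: h eE; rewrite !inE /= => /andP[/andP[-> ->] /andP[-> ->]] ->.
    by rewrite eqxx.
  by exists (k, k'); rewrite ?ee // !inE /= -ee h1 h2 h3 h4.
rewrite -mulnn -cardsX.
apply: (@card_le_rel _ _ _ _ (fun q y => y = ((q.1.1, q.2.1), (q.1.2, q.2.2)))).
  move=> q /[!inE] /andP[_ /and4P[h1 h2 h3 h4]]; eexists; last by [].
  by rewrite !inE /= h1 h4.
by move=> [[i j] [k k']] [[i' j'] [l l']] y _ _ -> [-> -> -> ->].
Qed.

End Triangles.

Section Whole.
Local Open Scope set_scope.
Variables (R : realType) (n : nat) (P : simple_planes R n).
Implicit Types (A B : {set 'I_n}) (i j k l m : 'I_n) (s t : signs n).

Section Family.
Variable (S : {set signs n}).

Definition whole i j : bool :=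
  (i != j) && [forall l, (l != i) && (l != j) ==> full P S [set i; j; l]].

Definition linked i j : bool :=
  (i != j) && [exists l, [&& l != i, l != j & full P S [set i; j; l]]].

Definition ended i j : bool :=
  (i != j) && [exists l, exists b, ([set i; j; l], l, b) \in line_ends P S].

Definition pairs (r : rel 'I_n) : {set 'I_n * 'I_n} := [set e : 'I_n * 'I_n | r e.1 e.2].

Definition touched : {set 'I_n} := [set i | [exists j, whole i j]].

Lemma wholeP i j l : whole i j -> l != i -> l != j -> full P S [set i; j; l].
Proof. by case/andP => _ /forallP/(_ l)/implyP h li lj; apply: h; rewrite li lj. Qed.

Lemma whole_sym i j : whole i j = whole j i.
Proof.
have h a b : whole a b -> whole b a; last by apply/idP/idP; exact: h.
move=> hw; have /andP[ab _] := hw; rewrite /whole eq_sym ab /=.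
apply/forallP => l; apply/implyP => /andP[lb la].
by rewrite (finset.setUC [set b]); exact: wholeP hw la lb.
Qed.

Lemma card_triple i j l : i != j -> l != i -> l != j -> #|[set i; j; l]| = 3%N.
Proof. by move=> ij li lj; rewrite finset.setUC cardsU1 !inE cards2 negb_or li lj ij. Qed.

Lemma not_full_end i j k l : i != j -> k != i -> k != j -> l != i -> l != j ->
  full P S [set i; j; k] -> ~~ full P S [set i; j; l] -> ended i j.
Proof.
move=> ij ki kj li lj h1 h2; rewrite -inner_vertex in h1; rewrite -inner_vertex in h2.
have z m : m != i -> m != j -> (i \in zeros P (vertex P [set i; j; m])) /\
    (j \in zeros P (vertex P [set i; j; m])).
  by move=> mi mj; rewrite zeros_vertex ?card_triple // !inE !eqxx orbT.
have [z1 z2] := z k ki kj; have [z3 z4] := z l li lj.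
have [m [b [hm _ _ _]]] := exists_end ij z1 z2 z3 z4 h1 h2.
by rewrite /ended ij; apply/existsP; exists m; apply/existsP; exists b.
Qed.

Lemma card_ended : (#|pairs ended| <= 9 * #|line_ends P S|)%N.
Proof.
apply: (@card_le_fibers _ _ _ _ _ (fun (e : 'I_n * 'I_n) (y : {set 'I_n} * 'I_n * bool) =>
  (e.1 \in y.1.1) && (e.2 \in y.1.1))).
  move=> [i j]; rewrite inE => /andP[_ /existsP[l /existsP[b h]]].
  by exists ([set i; j; l], l, b) => //; rewrite !inE !eqxx orbT.
move=> [[A m] b]; rewrite inE /= => /and4P[/eqP cA _ _ _].
have -> : 9%N = #|finset.setX A A| by rewrite cardsX cA.
by apply: subset_leq_card; apply/fintype.subsetP => -[i j]; rewrite !inE => /andP[_].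
Qed.

Lemma card_linked : (#|pairs linked| <= #|pairs whole| + 9 * #|line_ends P S|)%N.
Proof.
apply: leq_trans (leq_add (leqnn _) card_ended).
apply: leq_trans (leq_card_setU _ _); apply: subset_leq_card.
apply/fintype.subsetP => -[i j]; rewrite !inE /= => /andP[ij /existsP[k /and3P[ki kj hk]]].
have [//|/=] := boolP (whole i j).
rewrite negb_and ij /= => /forallPn[l]; rewrite negb_imply => /andP[/andP[li lj] hl].
exact: (not_full_end ij ki kj li lj hk hl).
Qed.

(** The three lines of a full vertex meet the thickening, so full vertices
are triangles of the graph [linked]. *)
Lemma full_triples_le : (#|full_triples P S| ^ 2 <= #|pairs linked| ^ 3)%N.
Proof.
apply: leq_trans (card_triangles linked); rewrite leq_exp2r //.
apply: (@card_le_rel _ _ _ _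
  (fun A (t : 'I_n * 'I_n * 'I_n) => A = [set t.1.1; t.1.2; t.2])); last first.
  by move=> A B t _ _ -> ->.
move=> A; rewrite inE => /andP[/eqP cA hA].
have [i iA] : exists i, i \in A by apply/card_gt0P; rewrite cA.
have [k kA ki] := other_member cA iA.
rewrite eq_sym in ki.
have [j [ji jk AE]] := triple_set cA iA kA ki.
have sub a b c : A = [set a; b; c] -> a != b -> a != c -> b != c -> linked a b.
  move=> e ab ac bc; rewrite /linked ab; apply/existsP; exists c.
  by rewrite eq_sym ac eq_sym bc -e.
have ij : i != j by rewrite eq_sym.
have kj : k != j by rewrite eq_sym.
have ki' : k != i by rewrite eq_sym.
exists (i, j, k) => //; rewrite !inE /=; apply/and3P; split.
- exact: (sub i j k).
- by apply: (sub i k j) => //; rewrite AE finset.setUAC.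
- by apply: (sub j k i) => //; rewrite AE; apply/setP => x; rewrite !inE; do !case: eqP.
Qed.

Lemma card_whole : (#|pairs whole| <= #|touched| * #|touched|)%N.
Proof.
rewrite -cardsX; apply: subset_leq_card; apply/fintype.subsetP => -[i j].
rewrite !inE /= => h; apply/andP; split; apply/existsP; first by exists j.
by exists i; rewrite whole_sym.
Qed.

End Family.

Variable (S S' : {set signs n}).
Hypothesis disj : forall s, s \in S -> s \in S' -> False.

Lemma full_disj A : #|A| = 3%N -> full P S A -> full P S' A -> False.
Proof.
move=> cA /fullP h /fullP h'.
have hs := upper_incident P (0 : 'cV[R]_3) cA.
exact: disj (h _ hs) (h' _ hs).
Qed.

Lemma touched_disjoint i : i \in touched S -> i \in touched S' -> False.
Proof.
rewrite !inE => /existsP[j hj] /existsP[l hl].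
have ij : i != j by case/andP: hj.
have il : i != l by case/andP: hl.
have [e|jl] := eqVneq j l.
  rewrite -e in hl.
  have [m mi mj] : exists2 m, m != i & m != j.
    have : (0 < #|~: [set i; j]|)%N.
      by rewrite cardsCs finset.setCK card_ord cards2 ij subn_gt0; exact: (three_planes P).
    by case/card_gt0P => m; rewrite !inE negb_or => /andP[? ?]; exists m.
  apply: (@full_disj [set i; j; m]); first exact: card_triple.
    exact: (wholeP hj).
  exact: (wholeP hl).
apply: (@full_disj [set i; j; l]); first by apply: card_triple; rewrite // eq_sym.
  by apply: (wholeP hj); rewrite eq_sym.
by rewrite finset.setUAC; apply: (wholeP hl); rewrite // eq_sym.
Qed.

(** A plane containing a whole line of [S] and one containing a whole line of
[S'] meet in a line that visits both families, so it has an end for [S]. *)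
Lemma card_touched : (#|touched S| * #|touched S'| <= 9 * #|line_ends P S|)%N.
Proof.
apply: leq_trans (card_ended S); rewrite -cardsX; apply: subset_leq_card.
apply/fintype.subsetP => -[i k]; rewrite finset.in_setX => /andP[iS kS'].
have ik : i != k by apply/eqP => e; move: kS'; rewrite /= -e; exact: touched_disjoint.
suff : ended S i k by rewrite !inE.
move: (iS) (kS'); rewrite !inE /= => /existsP[j hj] /existsP[l hl].
have ij : i != j by case/andP: hj.
have kl : k != l by case/andP: hl.
have jS : j \in touched S by rewrite inE; apply/existsP; exists i; rewrite whole_sym.
have lS : l \in touched S' by rewrite inE; apply/existsP; exists k; rewrite whole_sym.
have jk : j != k by apply/eqP => e; rewrite e in jS; exact: touched_disjoint jS kS'.
have il : i != l by apply/eqP => e; rewrite -e in lS; exact: touched_disjoint iS lS.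
apply: (@not_full_end S i k j l) => //; rewrite 1?eq_sym //.
  by rewrite finset.setUAC; apply: (wholeP hj); rewrite eq_sym.
apply/negP => h; apply: (@full_disj [set i; k; l] _ h).
  by apply: card_triple; rewrite // eq_sym.
have -> : [set i; k; l] = [set k; l; i] by apply/setP => x; rewrite !inE; do !case: eqP.
by apply: (wholeP hl).
Qed.

End Whole.

(** * Numerical estimates *)

Section Numeric.
Variable R : realType.

Lemma pow_le k (x y : R) : 0 <= x -> x <= y -> x ^+ k <= y ^+ k.
Proof. by move=> x0 xy; apply: lerXn2r; rewrite ?nnegrE // (le_trans x0). Qed.

(** The complement of the family has at least [d * n ^ 3 / 27] chambers. With
few boundary facets, the bound of [card_chambers_le] for the complement
leaves only one source for them, its whole lines, which then involve a
positive proportion of the planes. As [al * be] is at most a multiple of [b],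
few planes remain for the whole lines of the family itself. *)
Lemma lines_dichotomy (d n b F m al be W : R) : 0 < d -> d <= 1 -> 3 <= n ->
  0 <= b -> 0 <= F -> 0 <= m -> 0 <= al -> 0 <= be ->
  d * n ^+ 3 <= 27 * (8 * F + 25 * b) -> F ^+ 2 <= m ^+ 3 ->
  m <= be ^+ 2 + 108 * b -> W <= al * al -> al <= n -> al * be <= 108 * b ->
  W <= 108 * (300 * 100) / d * b.
Proof.
move=> d0 d1 n3 b0 F0 m0 al0 be0 h1 h2 h3 h4 h5 h6.
(* If neither [b] nor [be] reaches the proportion [e = d / M] of all lines and of
   all planes, the chambers are too few, as 27 * (8 * 109 + 25 / 3) < M. *)
have [M M0 ME] : exists2 M : R, 0 < M & M = 300 * 100 by exists (300 * 100); lra.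
rewrite -ME; pose e := d / M.
have e0 : 0 < e by rewrite divr_gt0.
have de : d = M * e by rewrite /e mulrC divfK ?gt_eqF.
have e1 : 300 * 100 * e <= 1 by rewrite -ME -de.
have n0 : 0 < n by lra.
have -> : 108 * M / d * b = 108 * b / e by rewrite de; field; lra.
rewrite ler_pdivlMr //.
have [be1|be1] := leP (e * n) be.
  have h7 : al * (e * n) <= al * be by exact: ler_wpM2l.
  have h8 : al * al <= al * n by exact: ler_wpM2l.
  have h9 : W * e <= al * n * e by rewrite ler_pM2r //; lra.
  by lra.
have [b1|b1] := leP (e * n ^+ 2) b.
  have h7 : al * al <= n ^+ 2 by rewrite expr2 ler_pM.
  have h8 : W * e <= n ^+ 2 * e by rewrite ler_pM2r //; lra.
  by lra.
exfalso.
have n2 : 0 < n ^+ 2 by rewrite exprn_gt0.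
have n3' : 0 < n ^+ 3 by rewrite exprn_gt0.
have be2 : be ^+ 2 <= e * n ^+ 2.
  have h7 : be ^+ 2 <= (e * n) ^+ 2 by apply: pow_le => //; exact: ltW.
  have h8 : e * (e * n ^+ 2) <= 1 * (e * n ^+ 2).
    by apply: ler_wpM2r; [apply: mulr_ge0; exact: ltW|lra].
  by move: h7; rewrite exprMn; lra.
have m1 : m <= 109 * e * n ^+ 2 by lra.
have F1 : F <= 109 * e * n ^+ 3.
  have en0 : 0 <= 109 * e * n ^+ 3 by rewrite mulr_ge0 ?(ltW n3') // mulr_ge0 // ltW.
  rewrite -(@ler_pXn2r _ 2%N) ?nnegrE //.
  apply: le_trans h2 _.
  have h7 : m ^+ 3 <= (109 * e * n ^+ 2) ^+ 3.
    exact: pow_le.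
  apply: le_trans h7 _.
  have -> : (109 * e * n ^+ 2) ^+ 3 = 109 * e * (109 * e * n ^+ 3) ^+ 2 by ring.
  by apply: ler_piMl; [exact: sqr_ge0|lra].
have bn : e * n ^+ 2 * 3 <= e * n ^+ 3.
  have -> : e * n ^+ 3 = e * n ^+ 2 * n by ring.
  by rewrite ler_pM2l // mulr_gt0.
have en : 0 < e * n ^+ 3 by rewrite mulr_gt0.
move: h1; rewrite de => h1.
have h9 : e * n ^+ 3 * (300 * 100) <= 27 * (8 * F + 25 * b).
  by rewrite -ME (mulrC _ M) mulrA.
lra.
Qed.

Lemma family_square (K b F m s : R) : 0 <= K -> 0 <= b -> (b = 0 \/ 1 <= b) ->
  0 <= F -> 0 <= m -> 0 <= s -> s <= 8 * F + 25 * b -> F ^+ 2 <= m ^+ 3 ->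
  m <= K * b + 108 * b -> s ^+ 2 <= (128 * (K + 108) ^+ 3 + (25 * 50)) * b ^+ 3.
Proof.
move=> K0 b0 hb F0 m0 s0 h1 h2 h3.
have hm : m ^+ 3 <= (K + 108) ^+ 3 * b ^+ 3.
  by rewrite -exprMn; apply: pow_le => //; lra.
have b23 : b ^+ 2 <= b ^+ 3.
  case: hb => [->|b1]; first by rewrite !expr0n.
  by rewrite (exprS b 2) ler_peMl // sqr_ge0.
have h4 : s ^+ 2 <= (8 * F + 25 * b) ^+ 2.
  exact: pow_le.
have h5 : (8 * F + 25 * b) ^+ 2 <= 128 * F ^+ 2 + (25 * 50) * b ^+ 2.
  by have := sqr_ge0 (8 * F - 25 * b); rewrite !expr2; lra.
lra.
Qed.

End Numeric.

Lemma cube_le_bin n : (2 < n)%N -> (n ^ 3 <= 27 * 'C(n, 3))%N.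
Proof.
case: n => [|[|[|m]]] // _.
have h := bin_ffact m.+3 3; rewrite !ffactnS ffactn0 /= !factS fact0 in h.
nia.
Qed.

Section Estimates.
Local Open Scope set_scope.
Variables (R : realType) (n : nat) (P : simple_planes R n).
Implicit Types (A B : {set 'I_n}) (i j k l m : 'I_n) (s t : signs n).

Definition realizable : {set signs n} := [set s | realized P s].

(** Distinct vertices have distinct upper chambers. *)
Lemma vertices_le : ('C(n, 3) <= #|realizable|)%N.
Proof.
have [f hf] := generic_ex P.
have -> : 'C(n, 3) = #|[set A : {set 'I_n} | #|A| == 3%N]| by rewrite card_draws card_ord.
apply: (@card_le_rel _ _ _ _ (fun A s => s = upper P f A)).
  move=> A; rewrite inE => /eqP cA; exists (upper P f A) => //.
  by rewrite inE (incident_vertex_realized cA (upper_incident P f cA)).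
by move=> A B s; rewrite !inE => /eqP cA /eqP cB -> ; exact: upper_inj.
Qed.

Variable S : {set signs n}.
Hypothesis hS : forall s, s \in S -> realized P s.

Lemma boundary_facets_compl : boundary_facets P (realizable :\: S) = boundary_facets P S.
Proof.
apply/setP => -[s i]; rewrite !inE /boundary_facet /=.
have [h1|//] := boolP (realized P s); have [h2|//] := boolP (realized P (flip i s)).
by rewrite !inE h1 h2 !andbT; case: (s \in S); case: (flip i s \in S).
Qed.

Definition whole_const (D : R) : R := 108 * (300 * 100) / (1 - D).

Lemma whole_const_gt0 (D : R) : D < 1 -> 0 < whole_const D.
Proof. by move=> D1; rewrite /whole_const; apply: divr_gt0; lra. Qed.

Lemma whole_bound (D : R) : 0 < D -> D < 1 ->
  #|S|%:R <= D * #|realizable|%:R ->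
  #|pairs (whole P S)|%:R <= whole_const D * #|boundary_facets P S|%:R.
Proof.
move=> D0 D1 hD; have [f hf] := generic_ex P.
pose S' := realizable :\: S.
have hS' s : s \in S' -> realized P s by rewrite finset.in_setD => /andP[_]; rewrite inE.
have SR : S \subset realizable by apply/fintype.subsetP => s /hS h; rewrite finset.in_set.
have cS' : #|S'|%:R = #|realizable|%:R - #|S|%:R :> R.
  by rewrite cardsD (finset.setIidPr SR) natrB // subset_leq_card.
have disj s : s \in S -> s \in S' -> False by rewrite finset.in_setD => ->.
have n3 := three_planes P.
apply: (@lines_dichotomy R (1 - D) n%:R #|boundary_facets P S|%:R #|full_triples P S'|%:R
  #|pairs (linked P S')|%:R #|touched P S|%:R #|touched P S'|%:R).
- by lra.
- by lra.
- by rewrite (ler_nat _ 3).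
- by [].
- by [].
- by [].
- by [].
- by [].
- have h1 := card_chambers_le hf hS'; rewrite boundary_facets_compl in h1.
  have h2 : #|S'|%:R <= 8 * #|full_triples P S'|%:R + 25 * #|boundary_facets P S|%:R :> R.
    by rewrite -!natrM -natrD ler_nat.
  have h3 : n%:R ^+ 3 <= 27 * #|realizable|%:R :> R.
    rewrite -natrX -natrM ler_nat; apply: leq_trans (cube_le_bin n3) _.
    by rewrite leq_mul2l vertices_le.
  have h4 : (1 - D) * n%:R ^+ 3 <= (1 - D) * (27 * #|realizable|%:R).
    by rewrite ler_pM2l //; lra.
  by lra.
- by rewrite -!natrX ler_nat full_triples_le.
- rewrite -natrX -natrM -natrD ler_nat; apply: leq_trans (card_linked _ _) _.
  apply: leq_add; first by rewrite -mulnn card_whole.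
  rewrite (_ : 108 = 9 * 12)%N // -mulnA leq_mul2l /= -boundary_facets_compl.
  exact: card_line_ends hf.
- by rewrite -natrM ler_nat card_whole.
- by rewrite ler_nat -[leqRHS](card_ord n) max_card.
- rewrite -!natrM ler_nat; apply: leq_trans (card_touched P disj) _.
  rewrite (_ : 108 = 9 * 12)%N // -mulnA leq_mul2l /=.
  exact: card_line_ends hf.
Qed.

Definition family_const (D : R) : R := 128 * (whole_const D + 108) ^+ 3 + (25 * 50).

Lemma family_bound (D : R) : 0 < D -> D < 1 ->
  #|S|%:R <= D * #|realizable|%:R ->
  #|S|%:R ^+ 2 <= family_const D * #|boundary_facets P S|%:R ^+ 3.
Proof.
move=> D0 D1 hD; have [f hf] := generic_ex P.
have K0 := ltW (whole_const_gt0 D1).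
apply: (@family_square R _ _ #|full_triples P S|%:R #|pairs (linked P S)|%:R) => //.
- case: #|boundary_facets P S| => [|b]; [by left|right]; by rewrite (ler_nat _ 1).
- by rewrite -!natrM -natrD ler_nat (card_chambers_le hf).
- by rewrite -!natrX ler_nat full_triples_le.
apply: le_trans (lerD (whole_bound D0 D1 hD) (lexx _)).
rewrite -natrM -natrD ler_nat; apply: leq_trans (card_linked _ _) _.
rewrite leq_add2l (_ : 108 = 9 * 12)%N // -mulnA leq_mul2l /=.
exact: card_line_ends hf.
Qed.

(** How a component of the thickening of a line is recorded: the whole line, or
an end of the component. *)
Definition line_data : {set 'I_n * 'I_n * option ('I_n * bool)} :=
  [set q : 'I_n * 'I_n * option ('I_n * bool) | (q.1.1 != q.1.2) &&
   match q.2 with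
   | None => whole P S q.1.1 q.1.2
   | Some e => ([set q.1.1; q.1.2; e.1], e.1, e.2) \in line_ends P S
   end].

Lemma card_line_data :
  (#|line_data| <= #|pairs (whole P S)| + 9 * #|line_ends P S|)%N.
Proof.
pose X := [set q in line_data | q.2 == None].
pose Y := [set q in line_data | q.2 != None].
have -> : line_data = X :|: Y.
  by apply/setP => q; rewrite finset.in_setU [q \in X]inE [q \in Y]inE -andb_orr orbN andbT.
apply: leq_trans (leq_card_setU _ _) _; apply: leq_add.
  apply: (@card_le_rel _ _ _ _ (fun (q : 'I_n * 'I_n * option ('I_n * bool)) e => e = q.1)).
    move=> [e o]; rewrite !inE /= => /andP[/andP[_ h] /eqP o0]; exists e => //.
    by rewrite inE; move: h; rewrite o0.
  move=> [e o] [e' o'] y; rewrite !inE /= => /andP[_ /eqP ->] /andP[_ /eqP ->].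
  by move=> -> ->.
apply: (@card_le_fibers _ _ _ _ _ (fun (q : 'I_n * 'I_n * option ('I_n * bool))
    (y : {set 'I_n} * 'I_n * bool) =>
  [&& q.1.1 \in y.1.1, q.1.2 \in y.1.1 & q.2 == Some (y.1.2, y.2)])).
  move=> [[i j] [[l b]|]] /[1!inE] /= /andP[/[1!inE] /= /andP[_ h]] // _.
  exists ([set i; j; l], l, b) => //.
  by rewrite /= !finset.in_setU !finset.in_set1 !eqxx ?orbT.
move=> [[A l] b]; rewrite inE /= => /and4P[/eqP cA _ _ _].
have -> : 9%N = #|finset.setX (finset.setX A A) [set Some (l, b)]|.
  by rewrite !cardsX cA cards1.
apply: subset_leq_card; apply/fintype.subsetP => -[[i j] o].
rewrite finset.in_set => /andP[_ /= /and3P[iA jA oE]].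
by rewrite !finset.in_setX /= iA jA finset.in_set1.
Qed.

End Estimates.

(** * Chambers, closures, thickening and facets *)

Lemma min1_pos (R : realType) (e : R) : 0 < e -> 0 < Num.min e 1.
Proof. by move=> e0; rewrite lt_min e0 ltr01. Qed.

Lemma min1_le1 (R : realType) (e : R) : Num.min e 1 <= 1.
Proof. by rewrite ge_min lexx orbT. Qed.

Section Ncard.
Variables (T : choiceType) (U : finType).

Lemma ncard_le (A : set T) (E : {set U}) (r : T -> U -> Prop) :
  (forall x, A x -> exists2 e, e \in E & r x e) ->
  (forall x y e, A x -> A y -> r x e -> r y e -> x = y) ->
  (ncard A <= #|E|)%N.
Proof.
move=> hr hinj; rewrite /ncard.
have [fA|iA] := pselect (finite_set A); last first.
  rewrite /fset_set; case: pselect => // _; by rewrite cardfs0.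
rewrite cardfE -cardsT.
have inA (x : fset_set A) : A (val x).
  by have := valP x; rewrite in_fset_set // inE.
apply: (@card_le_rel _ _ _ _ (fun x e => r (val x) e)).
  by move=> x _; exact: hr.
by move=> x y e _ _ h1 h2; apply: val_inj; apply: hinj h1 h2.
Qed.

Lemma ncard_ge (A : set T) (E : {set U}) (r : U -> T -> Prop) :
  finite_set A ->
  (forall e, e \in E -> exists2 x, A x & r e x) ->
  (forall e e' x, e \in E -> e' \in E -> r e x -> r e' x -> e = e') ->
  (#|E| <= ncard A)%N.
Proof.
move=> fA hr hinj; rewrite /ncard cardfE -cardsT.
apply: (@card_le_rel _ _ _ _ (fun e x => r e (val x))).
  move=> e /hr[x Ax rx].
  have xA : x \in fset_set A by rewrite in_fset_set // inE.
  by exists [` xA]%fset; rewrite ?inE.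
by move=> e e' x eE e'E h1 h2; apply: hinj h1 h2.
Qed.

Lemma finite_image_fin (f : U -> T) (A : set T) :
  (forall x, A x -> exists e, x = f e) -> finite_set A.
Proof.
move=> h; apply: (@sub_finite_set _ _ (f @` [set: U])).
  by move=> x /h[e ->]; exists e.
by apply: finite_image; exact: finite_finset.
Qed.

End Ncard.

Section Segments.
Variable R : realType.
Implicit Types (x y v : 'rV[R]_3) (u : 'cV[R]_3).

Lemma dot_continuous u : continuous (fun x => dot x u).
Proof.
have -> : (fun x => dot x u) = (fun x => \sum_(j <- enum 'I_3) x 0 j * u j 0).
  by apply/funext => x; rewrite /dot mxE big_enum.
elim: (enum 'I_3) => [|j s IH].
  rewrite (_ : (fun x => _) = cst 0); first exact: cst_continuous.
  by apply/funext => x; rewrite big_nil.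
rewrite (_ : (fun x => _) =
    (fun x : 'rV[R]_3 => x 0 j * u j 0 + \sum_(k <- s) x 0 k * u k 0)); last first.
  by apply/funext => x; rewrite big_cons.
move=> x; have h : {for x, continuous (fun x : 'rV[R]_3 => x 0 j * u j 0)}.
  apply: (@continuousM R 'rV[R]_3 (fun x : 'rV[R]_3 => x 0 j) (fun=> u j 0) x).
    exact: coord_continuous.
  exact: cst_continuous.
exact: (continuousD h (IH x)).
Qed.

Lemma ray_continuous x v : continuous (fun t : R => x + t *: v).
Proof.
move=> t; have h : {for t, continuous (fun=> x : 'rV[R]_3)} by exact: cst_continuous.
exact: (continuousD h (@scalel_continuous _ _ v t)).
Qed.

Lemma nbhs_ray x v (B : set 'rV[R]_3) : nbhs x B ->
  exists2 e : R, 0 < e & forall t, 0 <= t -> t <= e -> B (x + t *: v).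
Proof.
move=> hB; have := @ray_continuous x v 0 B.
rewrite /= scale0r addr0 => /(_ hB) /nbhs_ballP[e e0 he].
exists (e / 2); first by rewrite divr_gt0.
move=> t t0 te; apply: he; rewrite /ball /= sub0r normrN ger0_norm //.
by move: e0 => /= e0; lra.
Qed.

Lemma segment_component (X : set 'rV[R]_3) x y :
  (forall t : R, 0 <= t <= 1 -> X (x + t *: (y - x))) ->
  connected_component X x = connected_component X y.
Proof.
move=> h; apply/esym/same_connected_component.
pose g (t : R) := x + t *: (y - x).
have cg : connected (g @` `[0, 1]).
  apply: connected_continuous_connected; first exact: segment_connected.
  by apply: continuous_subspaceT; exact: ray_continuous.
apply: connected_component_sym.
apply: (@connected_component_max _ X (g @` `[0, 1])) => //.
- by exists 0; rewrite /= ?in_itv /= ?lexx ?ler01 // /g scale0r addr0.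
- by move=> _ [t /= + <-]; rewrite in_itv /=; exact: h.
- by exists 1; rewrite /= ?in_itv /= ?lexx ?ler01 // /g scale1r addrC subrK.
Qed.

End Segments.

Section Topology.
Variables (R : realType) (n : nat) (P : simple_planes R n).
Implicit Types (A B : {set 'I_n}) (i j k l m : 'I_n) (s t : signs n) (x y z v w : 'rV[R]_3).

Lemma height_continuous i : continuous (height P i).
Proof.
move=> x; have h : {for x, continuous (fun=> - offset P i)} by exact: cst_continuous.
exact: (continuousD (@dot_continuous R (normal P i) x) h).
Qed.

Lemma sg_height_open i (b : bool) : open [set x | 0 < sg R b * height P i x].
Proof.
have -> : [set x | 0 < sg R b * height P i x] =
    (fun x => sg R b * height P i x) @^-1` [set r : R | 0 < r] by [].
apply: open_comp; last exact: open_gt.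
move=> x _; have h : {for x, continuous (fun=> sg R b)} by exact: cst_continuous.
exact: (continuousM h (@height_continuous i x)).
Qed.

Lemma sg_height_closed i (b : bool) : closed [set x | 0 <= sg R b * height P i x].
Proof.
have -> : [set x | 0 <= sg R b * height P i x] =
    ~` [set x | 0 < sg R (~~ b) * height P i x].
  apply/seteqP; split=> x /=; rewrite sgN mulNr oppr_gt0 => h.
    by apply/negP; rewrite -leNgt.
  by rewrite leNgt; exact/negP.
by apply: open_closedC; exact: sg_height_open.
Qed.

Definition cell s : set 'rV[R]_3 := [set x | in_cell P s x].

Lemma cell_inj s t : realized P s -> cell s = cell t -> s = t.
Proof.
move=> /asboolP[x xs] e; have /in_cellP xt : cell t x by rewrite -e.
by apply/ffunP => i; apply: sg_pos_eq (in_cellP _ _ _ xs i) (xt i).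
Qed.

Lemma open_cell s : open (cell s).
Proof.
rewrite openE => x /in_cellP xs; rewrite /interior.
have h i : nbhs x [set y | 0 < sg R (s i) * height P i y].
  by apply: open_nbhs_nbhs; split; [exact: sg_height_open|exact: xs].
by apply: filterS (filter_forall _ h) => y hy; apply/in_cellP.
Qed.

Lemma incident_to_cell x y s (e : R) : incident P x s -> in_cell P s y ->
  0 < e -> e <= 1 -> in_cell P s (x + e *: (y - x)).
Proof.
move=> /incidentP xs /in_cellP ys e0 e1; apply/in_cellP => i.
rewrite height_seg; have := xs i; have := ys i.
move: (height P i x) (height P i y) => a b.
by case: (s i); rewrite /sg => h1 h2; nra.
Qed.

Lemma closure_cell s : realized P s -> closure (cell s) = [set x | incident P x s].
Proof.
move=> /asboolP[y ys]; apply/seteqP; split => x.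
  move=> hx; apply/incidentP => i.
  have hc := (closure_id [set x | 0 <= sg R (s i) * height P i x]).1 (@sg_height_closed i (s i)).
  have : closure (cell s) `<=` closure [set x | 0 <= sg R (s i) * height P i x].
    by apply: closure_subset => z /in_cellP/(_ i)/ltW.
  by rewrite -hc => /(_ _ hx).
move=> hx B /(@nbhs_ray R x (y - x))[e e0 he].
exists (x + Num.min e 1 *: (y - x)); split.
  exact: (incident_to_cell hx ys (min1_pos e0) (min1_le1 e)).
by apply: he; [exact: ltW (min1_pos e0)|rewrite ge_min lexx].
Qed.

Section Chambers.
Variable H : 'I_n -> set 'rV[R]_3.
Hypothesis HE : forall i, H i = [set x | height P i x = 0].

Lemma complE x : (~` \bigcup_i H i) x <-> forall i, height P i x != 0.
Proof.
split=> [h i|h [i _]]; last by rewrite HE /= => /eqP; exact/negP.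
by apply/eqP => hi; apply: h; exists i; rewrite // HE.
Qed.

Lemma flatE A x : flat H A x <-> A \subset zeros P x.
Proof.
split=> [h|/fintype.subsetP h i /= iA].
  by apply/fintype.subsetP => i iA; have := h i iA; rewrite HE inE /= => ->.
by have := h i iA; rewrite HE inE => /eqP.
Qed.

Lemma cell_compl s : cell s `<=` ~` \bigcup_i H i.
Proof.
move=> x /in_cellP xs; apply/complE => i; apply: contraTneq (xs i) => ->.
by rewrite mulr0 ltxx.
Qed.

(** A connected subset of the complement of the planes cannot change sign,
and a cell is convex. *)
Lemma component_cell s x : cell s x ->
  connected_component (~` \bigcup_i H i) x = cell s.
Proof.
move=> xs; have xc := cell_compl xs; apply/seteqP; split => y.
  move=> hy; apply/in_cellP => i.
  set K := connected_component _ x in hy *.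
  have cK : connected K by exact: component_connected.
  have KX : K `<=` ~` \bigcup_i H i by exact: connected_component_sub.
  have xK : K x by exact: connected_component_refl.
  pose B := K `&` [set z | 0 < sg R (s i) * height P i z].
  have BK : B = K.
    apply: cK.
    - by exists x; split=> //; exact: (in_cellP _ _ _ xs).
    - by exists [set z | 0 < sg R (s i) * height P i z] => //; exact: sg_height_open.
    - exists [set z | 0 <= sg R (s i) * height P i z]; first exact: sg_height_closed.
      apply/seteqP; split=> z [zK /= hz]; split=> //=; first exact: ltW.
      rewrite lt_neqAle hz andbT eq_sym mulf_neq0 ?sg_neq0 //.
      by have /complE := KX _ zK; apply.
  by move: hy; rewrite -BK => -[].
move=> ys; rewrite (@segment_component _ _ x y).
  by apply: connected_component_refl; exact: cell_compl ys.
move=> t /andP[t0 t1]; apply: (@cell_compl s).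
move: t0; rewrite le_eqVlt => /orP[/eqP <-|t0]; first by rewrite scale0r addr0.
exact: (incident_to_cell (in_cell_incident xs) ys t0 t1).
Qed.

Lemma chambersE : chambers H = [set cell s | s in [set s | realized P s]].
Proof.
apply/seteqP; split => [C [x xX <-]|C [s /= /asboolP[x xs] <-]].
  move/complE: xX => xX; pose s : signs n := [ffun i => 0 < height P i x].
  have xs : cell s x by apply/in_cellP => i; rewrite ffunE sg_pos.
  exists s; first by apply/asboolP; exists x.
  by rewrite (component_cell xs).
by exists x; [exact: cell_compl xs|exact: component_cell].
Qed.

Lemma chamber_cell s : realized P s -> chambers H (cell s).
Proof. by move=> hs; rewrite chambersE; exists s. Qed.

Lemma finite_chambers : finite_set (chambers H).
Proof.
by apply: (@finite_image_fin _ _ cell) => C; rewrite chambersE => -[s _ <-]; exists s.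
Qed.

Lemma ncard_chambers : (ncard (chambers H) <= #|realizable P|)%N.
Proof.
apply: (@ncard_le _ _ _ _ (fun C s => C = cell s)).
  by move=> C; rewrite chambersE => -[s hs <-]; exists s; rewrite // finset.in_set.
by move=> C C' s _ _ -> ->.
Qed.

Section Members.
Variable S : set (set 'rV[R]_3).
Hypothesis SH : S `<=` chambers H.

Definition members : {set signs n} :=
  [set s | realized P s && `[< S (cell s) >]]%SET.

Lemma membersP s : reflect (realized P s /\ S (cell s)) (s \in members).
Proof.
by rewrite finset.in_set; apply: (iffP andP) => -[h1 /asboolP h2]; split.
Qed.

Lemma members_realized s : s \in members -> realized P s.
Proof. by case/membersP. Qed.

Lemma finite_S : finite_set S.
Proof. exact: sub_finite_set SH finite_chambers. Qed.

Lemma ncard_members : ncard S = #|members|.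
Proof.
apply/eqP; rewrite eqn_leq; apply/andP; split.
  apply: (@ncard_le _ _ _ _ (fun C s => C = cell s)).
    move=> C SC; have := SH SC; rewrite chambersE => -[s hs e]; exists s => //.
    by apply/membersP; rewrite e.
  by move=> C C' s _ _ -> ->.
apply: (@ncard_ge _ _ _ _ (fun s C => C = cell s)); first exact: finite_S.
  by move=> s /membersP[_ h]; exists (cell s).
by move=> s s' C /membersP[hs _] _ -> ; exact: cell_inj.
Qed.

(** A small neighbourhood of [x] meets only the closed cells containing [x]; conversely
each cell having [x] in its closure has points as close to [x] as desired. *)
Lemma thickeningE x : thickening S x <-> inner P members x.
Proof.
split=> [hx|/innerP hx].
  apply/innerP => s xs; have rs := incident_realized xs; apply/membersP; split=> //.
  have /asboolP[y ys] := rs.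
  have [e e0 he] := @nbhs_ray R x (y - x) _ hx.
  pose z := x + Num.min e 1 *: (y - x).
  have zs : cell s z.
    exact: (incident_to_cell xs ys (min1_pos e0) (min1_le1 e)).
  have zc : closure (\bigcup_(C in S) C) z.
    by apply: he; [exact: ltW (min1_pos e0)|rewrite ge_min lexx].
  have [w [[C SC Cw] ws]] := zc _ (open_nbhs_nbhs (conj (@open_cell s) zs)).
  have := SH SC; rewrite chambersE => -[t rt e1].
  have -> : cell s = C; last by [].
  rewrite -e1; congr cell; rewrite -e1 in Cw.
  apply/ffunP => i; exact: sg_pos_eq (in_cellP _ _ _ ws i) (in_cellP _ _ _ Cw i).
rewrite /thickening /interior.
have h i : nbhs x [set y | height P i x != 0 ->
    0 < sg R (0 < height P i x) * height P i y].
  have [h0|h0] := eqVneq (height P i x) 0.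
    by apply: filterS (@filterT _ (nbhs x) _) => y _ /negP[]; exact/eqP.
  have : nbhs x [set y | 0 < sg R (0 < height P i x) * height P i y].
    by apply: open_nbhs_nbhs; split; [exact: sg_height_open|exact: sg_pos].
  by apply: filterS => y hy _; exact: hy.
apply: filterS (filter_forall _ h) => y hy.
pose s : signs n := [ffun i => 0 < height P i y].
have ys : incident P y s.
  apply/incidentP => i; rewrite ffunE.
  by have [->|/sg_pos/ltW//] := eqVneq (height P i y) 0; rewrite mulr0.
have /membersP[rs Ss] : s \in members.
  apply: hx; apply/incidentP => i.
  have [->|h0] := eqVneq (height P i x) 0; first by rewrite mulr0.
  by rewrite ffunE (sg_posE (hy i h0)) ltW // sg_pos.
have : closure (cell s) y by rewrite closure_cell.
by apply: closure_subset => z zs; exists (cell s).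
Qed.

Lemma stratumE A x : stratum H S A x <-> inner P members x /\ A \subset zeros P x.
Proof. by split=> -[/thickeningE h1 /flatE h2]. Qed.

End Members.

Hypothesis arrH : arrangement H.

(** The facet contains a relative neighbourhood in plane [i] of the crossing
point, so its affine hull is the whole plane. *)
Lemma facet_cell s i : realized P s -> realized P (flip i s) ->
  facet (closure (cell s)) (closure (cell s) `&` H i).
Proof.
move=> rs rf; rewrite closure_cell //; have [z [zi zs]] := crossing rs rf.
split.
  exists (- sg R (s i) *: normal P i), (- sg R (s i) * offset P i).
  have dE x : (x *m (- sg R (s i) *: normal P i)) 0 0 = - sg R (s i) * dot x (normal P i).
    by rewrite -scalemxAr mxE.
  split.
  - rewrite scaler_eq0 oppr_eq0 (negPf (sg_neq0 _ _)) /=; apply/eqP => n0.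
    have /asboolP[x /in_cellP/(_ i) h1] := rs; have /asboolP[y /in_cellP/(_ i)] := rf.
    move: h1; rewrite flip_id sgN /height /slope /dot n0 !mulmx0 !mxE sub0r; lra.
  - move=> x /incidentP/(_ i); rewrite dE /height /slope; lra.
  - congr (_ `&` _); rewrite HE; apply/seteqP; split=> x /=; rewrite dE /height /slope.
      by move=> h; have -> : dot x (normal P i) = offset P i by lra.
    by rewrite !mulNr => /oppr_inj /(mulfI (sg_neq0 _ _)) ->; rewrite subrr.
suff -> : affine_hull ([set x | incident P x s] `&` H i) = H i by exact: arrH.
apply/seteqP; split=> [x|x xi].
  by apply; split; [exists 2%N; exact: arrH|move=> y []].
move=> L [[m [p [M [_ LE]]]] FL].
have zF : ([set x | incident P x s] `&` H i) z.
  split; last by rewrite HE.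
  apply/incidentP => j; have [->|/zs/ltW//] := eqVneq j i.
  by rewrite zi mulr0.
have [e e0 he] := @small_step R _ (fun j => j != i) (fun j => sg R (s j) * height P j z)
  (fun j => sg R (s j) * slope P j (x - z)) zs.
have xi0 : height P i x = 0 by move: xi; rewrite HE.
have wF : ([set x | incident P x s] `&` H i) (z + e *: (x - z)).
  have wi : height P i (z + e *: (x - z)) = 0 by rewrite height_seg zi xi0 !mulr0 addr0.
  split; last by rewrite HE.
  apply/incidentP => j; have [->|ji] := eqVneq j i; first by rewrite wi mulr0.
  by rewrite heightZ mulrDr (mulrCA (sg R (s j))) ltW // he.
have := FL _ zF; have := FL _ wF; rewrite LE /= => h1 h2.
have h3 : (e *: (x - z) <= M)%MS.
  have -> : e *: (x - z) = (z + e *: (x - z) - p) - (z - p).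
    by rewrite opprB addrA addrNK addrC addKr.
  by rewrite addmx_sub // eqmx_opp.
have h4 : (x - z <= M)%MS.
  by rewrite -(scalerK (lt0r_neq0 e0) (x - z)) scalemx_sub.
have -> : x - p = (x - z) + (z - p) by rewrite addrA addrNK.
exact: addmx_sub.
Qed.

Lemma chamber_adj_flip s i : realized P s -> realized P (flip i s) ->
  chamber_adj (cell s) (cell (flip i s)).
Proof.
move=> rs rf; split.
  move=> /(cell_inj rs) e; have := flip_id i s; rewrite -e.
  by case: (s i).
exists (closure (cell s) `&` H i); split; first exact: facet_cell.
have -> : closure (cell s) `&` H i = closure (cell (flip i s)) `&` H i.
  rewrite !closure_cell // HE; apply/seteqP; split=> x [/= /incidentP xs xi]; split=> //.
    apply/incidentP => j; have [->|ji] := eqVneq j i; first by rewrite xi mulr0.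
    by rewrite flip_neq.
  apply/incidentP => j; have [->|ji] := eqVneq j i; first by rewrite xi mulr0.
  by have := xs j; rewrite flip_neq.
by apply: facet_cell; rewrite ?flipK.
Qed.

Lemma finite_edge_boundary S : finite_set (edge_boundary H S).
Proof.
apply: (@finite_image_fin _ _ (fun e : signs n * signs n => [set cell e.1; cell e.2])).
move=> e [[C [C' [hC hC' _ ->]]] _].
by move: hC hC'; rewrite chambersE => -[s _ <-] [t _ <-]; exists (s, t).
Qed.

Lemma boundary_facets_le S : S `<=` chambers H ->
  (#|boundary_facets P (members S)| <= 2 * ncard (edge_boundary H S))%N.
Proof.
move=> SH; pose E := [set e in boundary_facets P (members S) | e.1 \in members S]%SET.
have hE : (#|E| <= ncard (edge_boundary H S))%N.
  apply: (@ncard_ge _ _ _ _ (fun e X => X = [set cell e.1; cell (flip e.2 e.1)])).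
  - exact: finite_edge_boundary.
  - move=> [s i]; rewrite finset.in_set => /andP[].
    rewrite finset.in_set /= => /and3P[rs rf hb] sS.
    exists [set cell s; cell (flip i s)] => //; split.
      exists (cell s), (cell (flip i s)); split=> //; try exact: chamber_cell.
      exact: chamber_adj_flip.
    have /membersP[_ SC] := sS.
    exists (cell s); split; first by split; [left|].
    move=> C [[->//|->] SC']; move: hb; rewrite sS.
    by have -> : flip i s \in members S by apply/membersP.
  - have ED s i : (s, i) \in E -> boundary_facet P (members S) s i /\ s \in members S.
      by rewrite finset.in_set => /andP[]; rewrite finset.in_set.
    move=> [s i] [t j] X /ED[/and3P[rs rf hb] sS] /ED[/and3P[rt rft hbt] tS] -> /= e.
    have nf : flip i s \notin members S by move: hb; rewrite sS; case: (_ \in _).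
    have nft : flip j t \notin members S by move: hbt; rewrite tS; case: (_ \in _).
    have st : s = t.
      have [|] : [set cell t; cell (flip j t)] (cell s) by rewrite -e; left.
        exact: cell_inj.
      by move/(cell_inj rs) => es; move: nft; rewrite -es sS.
    rewrite -st in e nft rft *.
    have ff : flip i s = flip j s.
      have [|] : [set cell s; cell (flip j s)] (cell (flip i s)) by rewrite -e; right.
        by move/(cell_inj rf) => es; move: nf; rewrite es sS.
      exact: cell_inj.
    congr (_, _); apply/eqP; apply/negPn/negP => ij.
    have := flip_id i s; rewrite ff flip_neq //.
    by case: (s i).
apply: (@leq_trans (2 * #|E|)); last by rewrite leq_mul2l.
pose E' := [set e in boundary_facets P (members S) | e.1 \notin members S]%SET.
have -> : boundary_facets P (members S) = E :|: E'.
  apply/setP => e; rewrite finset.in_setU [e \in E]finset.in_set [e \in E']finset.in_set.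
  by rewrite -andb_orr orbN andbT.
apply: leq_trans (leq_card_setU _ _) _; rewrite mul2n -addnn leq_add2l.
apply: (@card_le_rel _ _ _ _ (fun (e e' : signs n * 'I_n) => e' = (flip e.2 e.1, e.2))).
  move=> [s i]; rewrite finset.in_set => /andP[].
  rewrite finset.in_set /= => /and3P[rs rf hb] sS.
  exists (flip i s, i) => //; rewrite finset.in_set; apply/andP; split.
    rewrite finset.in_set /boundary_facet /= flipK rf rs eq_sym.
    by [].
  by move: hb; rewrite (negPf sS) /=; case: (_ \in _).
move=> [s i] [t j] y _ _ -> /= [e ij]; rewrite -ij in e *; congr (_, _).
by rewrite -[s](flipK i) -[t](flipK i) e.
Qed.

End Chambers.
End Topology.

(** * Counting the components of the strata *)

Lemma card_sum_set (T U : finType) (X : {set T}) (Y : {set U}) :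
  (#|[set q : T + U | match q with inl x => x \in X | inr y => y \in Y end]%SET| <=
    #|X| + #|Y|)%N.
Proof.
have <- : #|(inl : T -> T + U) @: X| = #|X| by apply: card_imset; exact: inl_inj.
have <- : #|(inr : U -> T + U) @: Y| = #|Y| by apply: card_imset; exact: inr_inj.
apply: leq_trans (leq_card_setU _ _); apply: subset_leq_card.
apply/fintype.subsetP => -[x|y]; rewrite finset.in_set finset.in_setU => h.
  by rewrite imset_f.
by rewrite [X in _ || X]imset_f ?orbT.
Qed.

Section Components.
Variables (R : realType) (n : nat) (P : simple_planes R n).
Implicit Types (A B : {set 'I_n}) (i j k l m : 'I_n) (s t : signs n) (x y z v w : 'rV[R]_3).

Section Records.
Variable F : {set signs n}.

(** A component that meets lines is recorded by a piece of a line, one that meets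
planes but no line by a face, and another one is a single chamber. *)
Definition record : finType :=
  ('I_n * 'I_n * option ('I_n * bool) + (signs n * 'I_n) + signs n)%type.

(** The stratum carrying the piece: a record determines a component in each
of the strata of subsets of its base. *)
Definition base (q : record) : {set 'I_n} :=
  match q with
  | inl (inl d) => [set d.1.1; d.1.2]%SET
  | inl (inr e) => [set e.2]%SET
  | inr _ => finset.set0
  end.

Definition records : {set record} :=
  [set q : record | match q with
   | inl p => p \in [set p : ('I_n * 'I_n * option ('I_n * bool) + (signs n * 'I_n))%type |
       match p with
       | inl d => d \in line_data P F
       | inr e => e \in isolated_faces P F
       end]
   | inr s => s \in [set s in F | [exists i, boundary_facet P F s i]]
   end]%SET.

Lemma card_records :
  (#|records| <= #|line_data P F| + #|isolated_faces P F| +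
                 #|[set s in F | [exists i, boundary_facet P F s i]]%SET|)%N.
Proof. exact: leq_trans (card_sum_set _ _) (leq_add (card_sum_set _ _) (leqnn _)). Qed.

Lemma line_recordE d : ((inl (inl d) : record) \in records) = (d \in line_data P F).
Proof. by rewrite finset.in_set /= finset.in_set. Qed.

Lemma face_recordE e : ((inl (inr e) : record) \in records) = (e \in isolated_faces P F).
Proof. by rewrite finset.in_set /= finset.in_set. Qed.

Lemma chamber_recordE s :
  ((inr s : record) \in records) = (s \in F) && [exists i, boundary_facet P F s i].
Proof. by rewrite finset.in_set /= finset.in_set. Qed.

Definition recorded x (q : record) : Prop :=
  base q \subset zeros P x /\
  match q with
  | inl (inl (i, j, None)) => True
  | inl (inl (i, j, Some (l, b))) =>
      let w := vertex P [set i; j; l]%SET in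
      0 < sg R b * height P l x /\
      forall u : R, 0 <= u < 1 -> inner P F (x + u *: (w - x))
  | inl (inr (s, i)) => forall j, j != i -> 0 < sg R (s j) * height P j x
  | inr s => in_cell P s x
  end.

Lemma face_incident s i x : i \in zeros P x ->
  (forall j, j != i -> 0 < sg R (s j) * height P j x) -> incident P x s.
Proof.
rewrite inE => /eqP xi hx; apply/incidentP => j.
by have [->|/hx/ltW//] := eqVneq j i; rewrite xi mulr0.
Qed.

(** Two points with the same record are joined by a segment of the
thickening: along a whole line, towards the same end of a line, or within one
cell. *)
Lemma recorded_seg x y q (t : R) : q \in records -> recorded x q -> recorded y q ->
  inner P F x -> inner P F y -> 0 <= t <= 1 -> inner P F (x + t *: (y - x)).
Proof.
move=> hq [bx rx] [by_ ry] ix iy t01.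
case: q hq bx by_ rx ry => [[[[i j] [[l b]|]]|[s i]]|s] hq /= bx by_.
- move=> [lx hx] [ly hy]; move: hq; rewrite line_recordE finset.in_set /=.
  move=> /andP[ij]; rewrite finset.in_set /= => /and4P[/eqP cB lB _ _].
  set B := [set i; j; l]%SET in cB lB hx hy.
  have sub z : [set i; j]%SET \subset zeros P z -> B :\ l \subset zeros P z.
    move=> h; apply: fintype.subset_trans h; apply/fintype.subsetP => m.
    by rewrite !inE => /andP[/negPf ->]; rewrite orbF.
  have xE := on_line cB lB (sub _ bx); have yE := on_line cB lB (sub _ by_).
  move: xE yE hx hy lx ly; move: (height P l x) (height P l y) => a c xE yE hx hy lx ly.
  set D := dual P B l in xE yE; set w := vertex P B in xE yE hx hy.
  have a0 : a != 0 by apply: contraTneq lx => ->; rewrite mulr0 ltxx.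
  have c0 : c != 0 by apply: contraTneq ly => ->; rewrite mulr0 ltxx.
  have pE : x + t *: (y - x) = w + (a + t * (c - a)) *: D.
    by rewrite xE yE opprD addrACA subrr add0r -scalerBl scalerA -addrA -scalerDl.
  have toE (e u : R) (z : 'rV[R]_3) : z = w + e *: D -> z + u *: (w - z) = w + (e - u * e) *: D.
    by move=> ->; rewrite opprD addNKr scalerN scalerA -addrA -scalerBl.
  case/andP: t01 => t0 t1.
  have [h|h] := leP (sg R b * c) (sg R b * a).
    have : 0 <= t * (a - c) / a < 1.
      have -> : t * (a - c) / a = (t * (sg R b * a - sg R b * c)) / (sg R b * a).
        by field; rewrite sg_neq0 a0.
      apply/andP; split; first by apply: divr_ge0; [rewrite mulr_ge0 // subr_ge0|exact: ltW].
      rewrite ltr_pdivrMr //.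
      by move: h lx ly; move: (sg R b * a) (sg R b * c) => a' c' h lx ly; nra.
    move/hx; rewrite (toE a) // pE.
    by have -> : a - t * (a - c) / a * a = a + t * (c - a) by field.
  have : 0 <= (1 - t) * (c - a) / c < 1.
    have -> : (1 - t) * (c - a) / c = ((1 - t) * (sg R b * c - sg R b * a)) / (sg R b * c).
      by field; rewrite sg_neq0 c0.
    have t1' : 0 <= 1 - t by rewrite subr_ge0.
    apply/andP; split; first by apply: divr_ge0; [rewrite mulr_ge0 // subr_ge0 ltW|exact: ltW].
    rewrite ltr_pdivrMr //.
    by move: h lx ly; move: (sg R b * a) (sg R b * c) => a' c' h lx ly; nra.
  move/hy; rewrite (toE c) // pE.
  by have -> : c - (1 - t) * (c - a) / c * c = a + t * (c - a) by field.
- move=> _ _; move: hq; rewrite line_recordE finset.in_set /=.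
  move=> /andP[ij hw]; apply/negPn/negP => ni.
  have z z : [set i; j]%SET \subset zeros P z -> i \in zeros P z /\ j \in zeros P z.
    by move/fintype.subsetP => h; split; apply: h; rewrite !inE eqxx ?orbT.
  have [xi xj] := z _ bx; have [yi yj] := z _ by_.
  have pz m : m \in zeros P x -> m \in zeros P y -> m \in zeros P (x + t *: (y - x)).
    by rewrite !inE height_seg => /eqP -> /eqP ->; rewrite !mulr0 addr0.
  have [l [b [he /andP[li lj] _ _]]] := exists_end ij xi xj (pz i xi yi) (pz j xj yj) ix ni.
  move: he; rewrite finset.in_set /= => /and4P[_ _ _ /negP]; apply.
  exact: wholeP hw li lj.
- move=> rx ry; apply: (@inner_seg _ _ _ _ _ _ s) => //.
    by apply: face_incident rx; apply: (fintype.subsetP bx); rewrite inE.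
  by apply: face_incident ry; apply: (fintype.subsetP by_); rewrite inE.
- by move=> rx ry; apply: (@inner_seg _ _ _ _ _ _ s) => //; exact: in_cell_incident.
Qed.

Lemma line_recorded x i j : i != j -> [set i; j]%SET \subset zeros P x -> inner P F x ->
  exists o, (inl (inl (i, j, o)) : record) \in records /\ recorded x (inl (inl (i, j, o))).
Proof.
move=> ij sx ix.
have [xi xj] : i \in zeros P x /\ j \in zeros P x.
  by split; apply: (fintype.subsetP sx); rewrite !inE eqxx ?orbT.
have [hw|] := boolP (whole P F i j).
  by exists None; split; [rewrite line_recordE finset.in_set /= ij hw|split].
rewrite negb_and ij /= => /forallPn[l]; rewrite negb_imply => /andP[/andP[li lj] hl].
have cB := card_triple ij li lj.
have [|||l' [b [h1 h2 h3 h4]]] :=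
  @exists_end _ _ P F x (vertex P [set i; j; l]%SET) i j ij xi xj _ _ ix.
- by rewrite zeros_vertex // !inE eqxx.
- by rewrite zeros_vertex // !inE eqxx orbT.
- by rewrite inner_vertex.
exists (Some (l', b)); split; last by split.
by rewrite line_recordE finset.in_set /= ij.
Qed.

Lemma face_recorded x i : zeros P x = [set i]%SET -> inner P F x ->
  (forall y, inner P F y -> i \in zeros P y ->
     (forall t : R, 0 <= t <= 1 -> inner P F (x + t *: (y - x))) ->
     (#|zeros P y| <= 1)%N) ->
  exists s, (inl (inr (s, i)) : record) \in records /\ recorded x (inl (inr (s, i))).
Proof.
move=> zx /[dup] ix /innerP hx hy.
pose s : signs n := [ffun j => 0 < height P j x].
have xi : i \in zeros P x by rewrite zx inE.
have xs j : j != i -> 0 < sg R (s j) * height P j x.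
  move=> ji; rewrite ffunE sg_pos //.
  have : j \notin zeros P x by rewrite zx inE.
  by rewrite inE.
have xinc := face_incident xi xs.
have xf : incident P x (flip i s).
  by apply: (@face_incident _ i) => // j ji; rewrite flip_neq // xs.
exists s; split; last by split; rewrite /= ?zx.
rewrite face_recordE finset.in_set /= (hx _ xinc) (hx _ xf) /=.
apply/forallP => A; apply/implyP => /and3P[/eqP cA iA As].
apply/forallP => k; apply/implyP => kA; apply/implyP => ki; apply/negP => /half_fullP hh.
have ik : i != k by rewrite eq_sym.
have [j [ji jk AE]] := triple_set cA iA kA ik.
pose Y := [set i; j]%SET.
have YA : Y \subset A.
  by apply/fintype.subsetP => m; rewrite AE !inE => /orP[] ->; rewrite ?orbT.
have [e e0 /(_ e e0 (lexx _)) /=] := near_vertex cA YA As.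
set y := (_ + _) => -[yY yN].
have yinc : incident P y s.
  apply/incidentP => m; have [mY|/yN/ltW//] := boolP (m \in Y).
  by rewrite yY // mulr0.
have iy : inner P F y.
  apply/innerP => t /incidentP ty.
  have ts m : m \notin Y -> t m = s m.
    by move=> mY; apply/esym; exact: sg_pos_weak (yN m mY) (ty m).
  have kY : k \notin Y by rewrite !inE negb_or ki eq_sym.
  apply: hh; last by rewrite ts.
  apply/incidentP => m; have [mA|mA] := boolP (m \in A).
    by rewrite height_vertex // mulr0.
  rewrite ts; first exact: (incidentP _ _ _ As).
  by apply: contra mA => /(fintype.subsetP YA).
have : (#|zeros P y| <= 1)%N.
  apply: hy => //; first by rewrite inE yY // !inE eqxx.
  by move=> t t01; exact: (inner_seg xinc yinc).
apply/negP; rewrite -ltnNge (leq_trans _ (subset_leq_card (_ : Y \subset _))) //.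
  by rewrite cards2 eq_sym ji.
by apply/fintype.subsetP => m mY; rewrite inE yY.
Qed.

Lemma chamber_recorded x : zeros P x = finset.set0 -> inner P F x ->
  (forall s, s \in F -> realized P s) ->
  (forall y, inner P F y ->
     (forall t : R, 0 <= t <= 1 -> inner P F (x + t *: (y - x))) ->
     zeros P y = finset.set0) ->
  exists s, (inr s : record) \in records /\ recorded x (inr s).
Proof.
move=> zx /[dup] ix /innerP hx hF hy.
pose s : signs n := [ffun j => 0 < height P j x].
have xs : in_cell P s x.
  apply/in_cellP => j; rewrite ffunE sg_pos //.
  have : j \notin zeros P x by rewrite zx inE.
  by rewrite inE.
have xinc := in_cell_incident xs.
have sF := hx _ xinc.
exists s; split; last by split; [exact: finset.sub0set|].
rewrite chamber_recordE sF /=.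
have [A [cA _ /(_ s xinc) As]] := push_vertex P x.
have [i iA] : exists i, i \in A by apply/card_gt0P; rewrite cA.
apply/existsP; exists i; rewrite /boundary_facet (hF _ sF) sF /=.
have rf : realized P (flip i s).
  exact: incident_vertex_realized cA (incident_flip cA iA As).
rewrite rf /=; apply/negP => /eqP/esym fF.
have [y [yi ys]] := crossing (hF _ sF) rf.
have iyz : i \in zeros P y by rewrite inE yi.
have yinc := face_incident iyz ys.
have iy : inner P F y.
  apply/innerP => t /incidentP ty.
  have [->//|->//] : t = s \/ t = flip i s.
  by apply: flip_or => j ji; apply/esym; exact: sg_pos_weak (ys j ji) (ty j).
have := hy y iy (fun (u : R) u01 => inner_seg xinc yinc ix iy u01).
by move/setP/(_ i); rewrite iyz inE.
Qed.

End Records.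

Variables (H : 'I_n -> set 'rV[R]_3) (S : set (set 'rV[R]_3)).
Hypothesis HE : forall i, H i = [set x | height P i x = 0].
Hypothesis SH : S `<=` chambers H.

Notation F := (members P S).

Lemma stratum_seg A x y :
  stratum H S A x -> stratum H S A y ->
  (forall t : R, 0 <= t <= 1 -> inner P F (x + t *: (y - x))) ->
  connected_component (stratum H S A) x = connected_component (stratum H S A) y.
Proof.
move=> /(stratumE HE SH)[_ /fintype.subsetP xA] /(stratumE HE SH)[_ /fintype.subsetP yA] h.
apply: segment_component => t t01; apply/(stratumE HE SH); split; first exact: h.
apply/fintype.subsetP => i iA; move: (xA i iA) (yA i iA).
by rewrite !inE height_seg => /eqP -> /eqP ->; rewrite !mulr0 addr0.
Qed.

(** Record a component at a point lying on as many planes as possible, at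
most two being considered. *)
Lemma component_recorded A x : (#|A| <= 2)%N -> stratum H S A x ->
  exists2 y, stratum H S A y /\
    connected_component (stratum H S A) x = connected_component (stratum H S A) y &
    exists2 q, q \in records F & A \subset base q /\ recorded F y q.
Proof.
move=> cA Ax.
pose K y := stratum H S A y /\
  connected_component (stratum H S A) x = connected_component (stratum H S A) y.
have Kseg y z : K y -> stratum H S A z ->
    (forall t : R, 0 <= t <= 1 -> inner P F (y + t *: (z - y))) -> K z.
  by move=> [hy e] hz h; split; rewrite // e; exact: stratum_seg.
have Kin y : K y -> inner P F y /\ A \subset zeros P y.
  by case=> /(stratumE HE SH).
have [[y Ky c2]|n2] := pselect (exists2 y, K y & (1 < #|zeros P y|)%N).
  have [iy Ay] := Kin _ Ky.
  have [B [AB Bz cB]] := subset_between Ay cA c2.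
  have /cards2P[i [j [ij BE]]] : #|B| == 2%N by rewrite cB.
  rewrite BE in AB Bz.
  have [c [h1 h2]] := line_recorded ij Bz iy.
  by exists y => //; exists (inl (inl (i, j, c))).
have [[y Ky c1]|n1] := pselect (exists2 y, K y & (0 < #|zeros P y|)%N).
  have [iy Ay] := Kin _ Ky.
  have /eqP/cards1P[i zy] : #|zeros P y| = 1%N.
    apply/eqP; rewrite eqn_leq c1 andbT leqNgt; apply/negP => c2.
    by apply: n2; exists y.
  have [|s [h1 h2]] := face_recorded zy iy; last first.
    by exists y => //; exists (inl (inr (s, i))); rewrite //= -zy.
  move=> z iz zi hz; rewrite leqNgt; apply/negP => c2; apply: n2; exists z => //.
  apply: (Kseg y) => //; apply/(stratumE HE SH); split=> //.
  by apply: fintype.subset_trans Ay _; rewrite zy finset.sub1set.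
have z0 y : K y -> zeros P y = finset.set0.
  move=> Ky; apply/eqP; rewrite -cards_eq0 -leqn0 leqNgt; apply/negP => c1.
  by apply: n1; exists y.
have Kx : K x by [].
have [ix Ax'] := Kin _ Kx.
have A0 : A = finset.set0.
  by apply/eqP; rewrite -finset.subset0 -(z0 _ Kx).
have [||s [h1 h2]] := chamber_recorded (z0 _ Kx) ix; last first.
- by exists x => //; exists (inr s); rewrite //= A0.
- move=> y iy hy; apply: z0; apply: (Kseg x) => //.
  by apply/(stratumE HE SH); split=> //; rewrite A0 finset.sub0set.
- exact: members_realized.
Qed.

Lemma ncard_components A : (#|A| <= 2)%N ->
  (ncard (conn (stratum H S A)) <= #|[set q in records F | A \subset base q]%SET|)%N.
Proof.
move=> cA; apply: (@ncard_le _ _ _ _ (fun K q => q \in records F /\ exists2 x,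
  stratum H S A x /\ K = connected_component (stratum H S A) x & recorded F x q)).
  move=> _ [x Ax <-]; have [y [Ay e] [q hq [Aq rq]]] := component_recorded cA Ax.
  by exists q; [rewrite finset.in_set hq|split=> //; exists y].
move=> K K' q _ _ [hq [x [Ax ->] rx]] [_ [y [Ay ->] ry]].
apply: stratum_seg => // t t01.
have /(stratumE HE SH)[ix _] := Ax; have /(stratumE HE SH)[iy _] := Ay.
exact: (recorded_seg hq rx ry).
Qed.

Lemma sum_components :
  (\sum_(A in supp H S | (#|A| <= 2)%N) ncard (conn (stratum H S A)) <=
     4 * #|records F|)%N.
Proof.
apply: (@leq_trans (\sum_(A : {set 'I_n}) \sum_(q in records F) (A \subset base q))).
  rewrite big_mkcond; apply: leq_sum => A _; case: ifP => // /andP[_ cA].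
  apply: leq_trans (ncard_components cA) _.
  rewrite -sum1_card big_mkcond [in leqRHS]big_mkcond; apply: leq_sum => q _.
  by rewrite finset.in_set; case: (q \in _); case: (A \subset _).
rewrite exchange_big /= mulnC -sum_nat_const; apply: leq_sum => q _.
apply: (@leq_trans #|powerset (base q)|).
  rewrite -sum1_card [in leqRHS]big_mkcond; apply: leq_sum => A _.
  by rewrite powersetE; case: (A \subset _).
rewrite card_powerset (leq_exp2l _ 2) //.
by case: q => [[[[i j] o]|[s i]]|s] /=; rewrite ?cards2 ?cards1 ?cards0 //; case: (i != j).
Qed.

End Components.

(** * From hyperplanes in general position to the theorem *)

(** The cokernel of the spanning matrix is nonzero, and a nonzero column of
it has the right kernel for reasons of rank. *)
Lemma plane_equation (R : realType) (L : set 'rV[R]_3) : affine_subspace 2 L ->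
  exists a c, L = [set x | dot x a = c].
Proof.
move=> [p [M [rM ->]]].
have K0 : cokermx M != 0 by rewrite cokermx_eq0 /row_full rM.
have [i [j Kij]] := matrix0Pn _ K0.
pose a := col j (cokermx M).
have a0 : a != 0 by apply/matrix0Pn; exists i, 0; rewrite mxE.
have sub : (M <= kermx a)%MS.
  by apply/sub_kermxP; rewrite /a colE mulmxA mulmx_coker mul0mx.
have rk : \rank (kermx a) = 2%N.
  rewrite mxrank_ker -mxrank_tr rank_rV.
  by rewrite (_ : a^T != 0) // -trmx0 (inj_eq trmx_inj).
have /eqmxP eqM : (M == kermx a)%MS by rewrite -(geq_leqif (mxrank_leqif_eq sub)) rk rM.
exists a, (dot p a); apply/seteqP; split=> x /=; rewrite eqM.
  move/sub_kermxP; rewrite mulmxBl => /(congr1 (fun m : 'M[R]_1 => m 0 0)).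
  by rewrite !mxE => /eqP; rewrite subr_eq0 => /eqP; rewrite /dot !mxE.
move=> h; apply/sub_kermxP; apply/matrixP => u v; rewrite !ord1.
by have := dotB x p a; rewrite /dot in h *; rewrite h subrr => ->; rewrite mxE.
Qed.

Lemma convex_pos (R : realType) (t u v : R) : 0 <= t -> t <= 1 ->
  0 < u -> 0 < v -> 0 < (1 - t) * u + t * v.
Proof. by move=> t0 t1 u0 v0; have [h|h] := lerP t (1 / 2); nra. Qed.

Section Construction.
Variables (R : realType) (n : nat) (H : 'I_n -> set 'rV[R]_3).
Variables (a : 'I_n -> 'cV[R]_3) (c : 'I_n -> R).
Hypothesis Ha : forall i, H i = [set x | dot x (a i) = c i].

(** Points outside the planes with the same signs are joined by a segment. *)
Lemma chambers_le_signs : (ncard (chambers H) <= 2 ^ n)%N.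
Proof.
have -> : (2 ^ n = #|[set: signs n]%SET|)%N by rewrite cardsT card_ffun card_bool card_ord.
apply: (@ncard_le _ _ _ _ (fun K (s : signs n) => exists x, [/\ (~` \bigcup_i H i) x,
    K = connected_component (~` \bigcup_i H i) x &
    forall i, s i = (c i < dot x (a i))])).
  move=> _ [x xX <-]; exists [ffun i => c i < dot x (a i)]; first by rewrite inE.
  by exists x; split=> // i; rewrite ffunE.
move=> K K' s _ _ [x [xX -> hx]] [y [yX -> hy]].
apply: segment_component => t /andP[t0 t1] [i _]; rewrite Ha /= dotD dotZ dotB => e.
have nz z : (~` \bigcup_i H i) z -> dot z (a i) != c i.
  by move=> zX; apply/eqP => zi; apply: zX; exists i; rewrite // Ha.
have := hx i; rewrite hy; move: (nz _ xX) (nz _ yX) e.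
move: (dot x (a i)) (dot y (a i)) (c i) => p q r.
move=> + + e; case: (ltrgtP r p) => // h1 _; case: (ltrgtP r q) => // h2 _ _.
  have : 0 < (1 - t) * (p - r) + t * (q - r) by apply: convex_pos; rewrite ?subr_gt0.
  by lra.
have : 0 < (1 - t) * (r - p) + t * (r - q) by apply: convex_pos; rewrite ?subr_gt0.
by lra.
Qed.

Hypothesis n3 : (2 < n)%N.
Hypothesis gp : general_position H.

Lemma flat_normal A x : flat H A x <-> forall i, i \in A -> dot x (a i) = c i.
Proof.
by split=> h i iA; have := h i iA; rewrite Ha.
Qed.

Lemma free_normals (A : {set 'I_n}) (d : 'rV[R]_3) : #|A| = 3%N ->
  (forall i, i \in A -> dot d (a i) = 0) -> d = 0.
Proof.
move=> cA hd; have [|p [M [rM FE]]] := gp.1 A; first by rewrite cA.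
move: rM; rewrite cA => /eqP; rewrite subnn mxrank_eq0 => /eqP M0.
have pF : flat H A p by rewrite FE /= subrr sub0mx.
have : flat H A (p + d).
  move/flat_normal: pF => pF; apply/flat_normal => i iA.
  by rewrite dotD pF // hd // addr0.
by rewrite FE /= addrC addKr M0 submx0 => /eqP.
Qed.

Lemma four_normals (A : {set 'I_n}) (x : 'rV[R]_3) : #|A| = 4%N ->
  ~ (forall i, i \in A -> dot x (a i) = c i).
Proof.
move=> cA h; have : flat H A x by exact/flat_normal.
by rewrite (gp.2 A cA).
Qed.

Definition planes : simple_planes R n := SimplePlanes n3 free_normals four_normals.

Lemma planesE i : H i = [set x | height planes i x = 0].
Proof.
rewrite Ha; apply/seteqP; split=> x /=; rewrite /height /slope /=.
  by move=> ->; rewrite subrr.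
by move/eqP; rewrite subr_eq0 => /eqP.
Qed.

End Construction.

Section Binomials.
Variable R : realType.
Implicit Types k : R.

Lemma sum_rbinom3 k : \sum_(0 <= i < 3) rbinom k i = 1 + k + k * (k - 1) / 2.
Proof.
rewrite !big_nat_recl // big_geq // /rbinom !big_ord_recl !big_ord0 /=.
by rewrite !factS fact0 /bump !leq0n !add1n ?natrM; field.
Qed.

Lemma sum_rbinom4 k : \sum_(0 <= i < 4) rbinom k i = (k ^+ 3 + 5 * k + 6) / 6.
Proof.
rewrite !big_nat_recl // big_geq // /rbinom !big_ord_recl !big_ord0 /=.
by rewrite !factS fact0 /bump !leq0n !add1n ?natrM; field.
Qed.

Lemma cube_le (u : R) : 0 <= u -> u <= 1 -> u ^+ 3 <= u.
Proof. by move=> u0 u1; rewrite -[leRHS]expr1; apply: ler_wiXn2l. Qed.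

Lemma binom_le_boundary (Q e k s C : R) : 1 <= Q -> 0 <= e -> 2 <= k ->
  s = \sum_(0 <= i < 4) rbinom k i -> s ^+ 2 <= Q * e ^+ 3 ->
  0 <= C -> C <= (288 * Q)^-1 ->
  C * \sum_(0 <= i < 3) rbinom k i <= e.
Proof.
move=> Q1 e0 k2; rewrite sum_rbinom4 sum_rbinom3 => sE hs C0 hC.
set T := 1 + k + _.
have Q0 : 0 < 288 * Q by lra.
have T0 : 0 <= T by rewrite /T; nra.
have TE : T <= 2 * k ^+ 2 by rewrite /T expr2; nra.
have k3 : 0 <= k ^+ 3 by rewrite exprn_ge0 //; lra.
have ks : k ^+ 3 <= 6 * s by rewrite sE; lra.
have T3 : T ^+ 3 <= 288 * Q * e ^+ 3.
  have h1 := @pow_le R 3 _ _ T0 TE.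
  have h2 := @pow_le R 2 _ _ k3 ks.
  have e1 : (2 * k ^+ 2) ^+ 3 = 8 * (k ^+ 3) ^+ 2 by ring.
  have e2 : (6 * s) ^+ 2 = 36 * s ^+ 2 by ring.
  by lra.
have C1 : C ^+ 3 * (288 * Q) <= 1.
  have h1 := @pow_le R 3 _ _ C0 hC.
  have i0 : 0 < (288 * Q)^-1 by rewrite invr_gt0.
  have i1 : (288 * Q)^-1 <= 1 by rewrite invf_le1 //; lra.
  have h2 := cube_le (ltW i0) i1.
  have h3 : C ^+ 3 <= (288 * Q)^-1 by lra.
  by have := ler_wpM2r (ltW Q0) h3; rewrite mulVf ?gt_eqF.
rewrite -(@ler_pXn2r _ 3) ?nnegrE ?mulr_ge0 // exprMn.
have C3 : 0 <= C ^+ 3 by rewrite exprn_ge0.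
have h4 := ler_wpM2l C3 T3.
have e3 : 0 <= e ^+ 3 by rewrite exprn_ge0.
have h5 := ler_wpM2r e3 C1.
lra.
Qed.

Lemma power_le_boundary (Q e s : R) : 1 <= Q -> 0 <= e -> 0 <= s ->
  s ^+ 2 <= Q * e ^+ 3 -> Q^-1 * s `^ (2%:R / 3%:R) <= e.
Proof.
move=> Q1 e0 s0 hs.
have Q0 : 0 < Q by lra.
have i0 : 0 <= Q^-1 by rewrite invr_ge0 ltW.
have i1 : Q^-1 <= 1 by rewrite invf_le1.
rewrite -(@ler_pXn2r _ 3) ?nnegrE ?mulr_ge0 ?powR_ge0 // exprMn.
have -> : (s `^ (2%:R / 3%:R)) ^+ 3 = s ^+ 2.
  rewrite -powR_mulrn ?powR_ge0 // -powRrM divfK ?pnatr_eq0 //.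
  by rewrite powR_mulrn.
have i3 := cube_le i0 i1.
have s2 : 0 <= s ^+ 2 by rewrite sqr_ge0.
apply: le_trans (ler_wpM2r s2 i3) _.
by rewrite mulrC ler_pdivrMr // mulrC.
Qed.

End Binomials.

Lemma record_count (t q l i u w e b : nat) :
  (t <= 4 * q)%N -> (q <= l + i + u)%N -> (l <= w + 9 * e)%N -> (e <= 12 * b)%N ->
  (i <= 56 * b)%N -> (u <= b)%N -> (t <= 4 * (w + 165 * b))%N.
Proof. lia. Qed.

Theorem theorem4p2 (R : realType) (D : R) (D_gt0 : 0 < D) (D_lt1 : D < 1) :
  exists C c : R, [/\ 0 < C, 0 < c &
    forall (n : nat) (H : 'I_n -> set 'rV[R]_3) (S : set (set 'rV[R]_3)) (k : R),
      arrangement H -> general_position H ->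
      S `<=` chambers H ->
      2 <= k -> (ncard S)%:R = \sum_(0 <= i < 4) rbinom k i ->
      (ncard S)%:R <= D * (ncard (chambers H))%:R ->
      [/\ (ncard (edge_boundary H S))%:R >=
            C * (\sum_(A in supp H S | (#|A| <= 2)%N) ncard (conn (stratum H S A)))%:R,
          (ncard (edge_boundary H S))%:R >= C * \sum_(0 <= i < 3) rbinom k i
        & (ncard (edge_boundary H S))%:R >= c * (ncard S)%:R `^ (2%:R / 3%:R)]].
Proof.
(* A record has a base with at most 4 subsets; there are 9 * 12 + 56 + 1 = 165
   records per boundary facet, besides those of whole lines, and each boundary
   facet is listed twice. *)
pose K := whole_const D; pose Q := 8 * family_const D.
have K0 : 0 < K := whole_const_gt0 D_lt1.
have Q1 : 1 <= Q.
  have : 0 <= (whole_const D + 108) ^+ 3 by rewrite exprn_ge0 // -/K; lra.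
  by rewrite /Q /family_const; lra.
have w0 : 0 < 8 * (K + 165) by lra.
have q0 : 0 < 288 * Q by lra.
exists (Num.min (8 * (K + 165))^-1 (288 * Q)^-1), Q^-1.
split; first by rewrite lt_min !invr_gt0 w0 q0.
  by rewrite invr_gt0; lra.
move=> n H S k arrH gp SH k2 cardS SD.
set C := Num.min _ _.
have C0 : 0 <= C by rewrite le_min !invr_ge0 !ltW.
have [a /choice[c Ha]] : exists a : 'I_n -> 'cV[R]_3, forall i, exists c : R,
    H i = [set x | dot x (a i) = c].
  by have /choice[a ha] := fun i => plane_equation (arrH i); exists a.
(* Two planes leave at most four chambers, and [S] has at least four of them
   without having them all. *)
have n3 : (2 < n)%N.
  rewrite ltnNge; apply/negP => n2.
  have hc : (ncard (chambers H))%:R <= 4 :> R.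
    rewrite (ler_nat _ _ 4); apply: leq_trans (chambers_le_signs Ha) _.
    by rewrite (leq_pexp2l _ n2).
  have hS : 4 <= (ncard S)%:R :> R.
    rewrite cardS sum_rbinom4; have : 8 <= k ^+ 3.
      by rewrite (_ : 8 = 2 ^+ 3); [exact: pow_le|ring].
    lra.
  have := ler_wpM2l (ltW D_gt0) hc; lra.
pose P := planes Ha n3 gp.
have HE : forall i, H i = [set x | height P i x = 0] by exact: planesE.
pose F := members P S.
have hF s : s \in F -> realized P s by exact: members_realized.
have cS : ncard S = #|F| := ncard_members HE SH.
have FD : #|F|%:R <= D * #|realizable P|%:R.
  rewrite -cS; apply: le_trans SD _; rewrite ler_pM2l // ler_nat.
  exact: ncard_chambers HE.
have b2 : #|boundary_facets P F|%:R <= 2 * (ncard (edge_boundary H S))%:R :> R.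
  by rewrite -natrM ler_nat; exact: boundary_facets_le.
set e : R := (ncard (edge_boundary H S))%:R in b2 *.
have e0 : 0 <= e by [].
have s2 : (ncard S)%:R ^+ 2 <= Q * e ^+ 3.
  rewrite cS; apply: le_trans (family_bound hF D_gt0 D_lt1 FD) _.
  have h := @pow_le R 3 _ _ (ler0n _ _) b2.
  rewrite /Q (mulrC 8) -mulrA ler_wpM2l //; first by move: Q1; rewrite /Q; lra.
  by apply: le_trans h _; rewrite exprMn; lra.
split.
- have [f hf] := generic_ex P.
  have h1 := sum_components HE SH; rewrite -/F in h1.
  have h2 := card_records P F; have h3 := card_line_data P F.
  have h4 := card_line_ends F hf; have h5 := card_isolated_faces hf hF.
  have h6 := card_boundary_chambers P F.
  have h7 := whole_bound hF D_gt0 D_lt1 FD; rewrite -/K in h7.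
  have h8 : (\sum_(A in supp H S | (#|A| <= 2)%N) ncard (conn (stratum H S A)))%:R <=
      4 * (#|pairs (whole P F)|%:R + 165 * #|boundary_facets P F|%:R) :> R.
    by rewrite -!natrM -natrD -natrM ler_nat; exact: record_count h1 h2 h3 h4 h5 h6.
  have Cw : C <= (8 * (K + 165))^-1 by rewrite ge_min lexx.
  apply: le_trans (ler_wpM2l C0 h8) _.
  have h9 : 4 * (#|pairs (whole P F)|%:R + 165 * #|boundary_facets P F|%:R) <= (8 * (K + 165)) * e.
    have h10 := ler_wpM2l (ltW K0) b2; lra.
  apply: le_trans (ler_wpM2l C0 h9) _.
  have h11 := ler_wpM2r (mulr_ge0 (ltW w0) e0) Cw.
  by move: h11; rewrite mulKf // gt_eqF.
- apply: (binom_le_boundary Q1 e0 k2 cardS s2 C0).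
  by rewrite ge_min lexx orbT.
- exact: power_le_boundary.
Qed.
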